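(* Let $\mathbb{K}$ be an algebraically closed field of characteristic zero and let $N=2m\geq 2$ be even. Then $$\operatorname{Aut}(\mathcal{H}_{N})\cong \operatorname{Aut}(\mathcal{H}_{N}')\cong \mathbf{GSp}_{N}(\mathbb{Z})\ltimes (\mathbb{K}^{\times})^{N}.$$
   Context: Let $A_N=\mathbb{K}[t_1^{\pm1},\dots,t_N^{\pm1}]$, $d_i=t_i\frac{\partial}{\partial t_i}$, and for $\bm{r}=(r_1,\dots,r_N)^\top\in\mathbb{Z}^N$ write $t^{\bm r}=t_1^{r_1}\cdots t_N^{r_N}$. Let $(\cdot,\cdot)$ be the bilinear form on $\mathbb{K}^N$ with $(e_i,e_j)=\delta_{ij}$ ($e_i$ the standard basis vectors), and $\mathbb{Z}^N\subset\mathbb{K}^N$. For $u\in\mathbb{K}^N$, $\bm r\in\mathbb{Z}^N$ put $D(u,\bm r)=\sum_{i=1}^N u_i t^{\bm r}d_i$, a derivation of $A_N$. Let $\bm J=\begin{pmatrix} O_m & I_m\\ -I_m & O_m\end{pmatrix}$ and $\overline{\bm r}=\bm J\bm r$. Put $h_{\bm r}=D(\overline{\bm r},\bm r)$ (so $h_{\bm 0}=0$) and $\mathfrak h=\operatorname{span}_{\mathbb{K}}\{d_1,\dots,d_N\}=\{D(u,\bm 0):u\in\mathbb{K}^N\}$. The Hamiltonian Lie algebra is $\mathcal{H}_N=\operatorname{span}_{\mathbb{K}}\{h_{\bm r}:\bm r\in\mathbb{Z}^N\setminus\{\bm 0\}\}\oplus\mathfrak h$, a Lie subalgebra of the Lie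 algebra of derivations of $A_N$ under the commutator bracket; in particular $[h_{\bm r},h_{\bm s}]=(\overline{\bm r},\bm s)h_{\bm r+\bm s}$ and $[D(u,\bm 0),h_{\bm r}]=(u,\bm r)h_{\bm r}$. Its derived subalgebra is $\mathcal{H}_N'=[\mathcal{H}_N,\mathcal{H}_N]=\operatorname{span}_{\mathbb{K}}\{h_{\bm r}:\bm r\neq\bm 0\}$. The conformal symplectic group is $\mathbf{GSp}_N(\mathbb{Z})=\{\bm Q\in\mathbf{GL}_N(\mathbb{Z}):\bm Q^\top\bm J\bm Q=\pm\bm J\}$. The symbol $\ltimes$ denotes a semidirect product in which $(\mathbb{K}^\times)^N$ is the normal subgroup. *)

(* Defs.v *)
From HB Require Import structures.
From mathcomp Require Import all_boot all_order all_algebra.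
From mathcomp Require Import finmap.
From mathcomp.multinomials Require Import monalg.
Set Implicit Arguments. Unset Strict Implicit. Unset Printing Implicit Defensive.
Import Order.TTheory GRing.Theory Num.Theory.
Local Open Scope ring_scope.
Local Open Scope fset_scope.

Section Hamiltonian.
Variables (K : fieldType) (m : nat).
Local Notation N := (m + m)%N.

Definition ZN := 'cV[int]_N.
Definition KN := 'cV[K]_N.

Definition dotZ (u : KN) (r : ZN) : K := \sum_(i < N) u i 0 * (r i 0)%:~R.

Definition Jmx : 'M[int]_N := block_mx 0 1%:M (- 1%:M) 0.

Definition rbarK (r : ZN) : KN := map_mx (fun z : int => z%:~R) (Jmx *m r).

(* The Witt algebra W_N = Der(A_N): an element f is the finite sum
   \sum_r D(f@_r, r), where D(u, r) = \sum_i u_i t^r d_i. *)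
Definition W := {malg KN [ZN]}.

Definition scaleW (a : K) (f : W) : W := [malg r in msupp f => a *: f@_r].

(* commutator of derivations: [D(u,r), D(v,s)] = D((u,s) v - (v,r) u, r+s),
   extended bilinearly *)
Definition bracketW (f g : W) : W :=
  \sum_(r <- msupp f) \sum_(s <- msupp g)
     << (dotZ (f@_r) s *: g@_s - dotZ (g@_s) r *: f@_r) *g (r + s) >>.

(* H_N = span{ h_r = D(\bar r, r) : r <> 0 } (+) span{ D(u, 0) } *)
Definition inH (f : W) : Prop :=
  forall r : ZN, r != 0 -> exists c : K, f@_r = c *: rbarK r.

(* H_N' = span{ h_r : r <> 0 } *)
Definition inH' (f : W) : Prop := f@_0 = 0 /\ inH f.

Definition isLieAut (P : W -> Prop) (phi : {f : W | P f} -> {f : W | P f}) : Prop :=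
  bijective phi /\
  (forall (a : K) (x y z : {f : W | P f}),
      sval z = (scaleW a (sval x) + sval y)%R ->
      sval (phi z) = (scaleW a (sval (phi x)) + sval (phi y))%R) /\
  (forall x y z : {f : W | P f},
      sval z = bracketW (sval x) (sval y) ->
      sval (phi z) = bracketW (sval (phi x)) (sval (phi y))).

Definition inGSp (Q : 'M[int]_N) : Prop :=
  Q \in unitmx /\ (Q^T *m Jmx *m Q = Jmx \/ Q^T *m Jmx *m Q = - Jmx).

Definition inTorus (l : KN) : Prop := forall i, l i 0 != 0.
Definition tmul (l1 l2 : KN) : KN := \col_i (l1 i 0 * l2 i 0).

Definition gsp_action (act : 'M[int]_N -> KN -> KN) : Prop :=
  (forall Q l, inGSp Q -> inTorus l -> inTorus (act Q l)) /\
  (forall Q l1 l2, inGSp Q -> inTorus l1 -> inTorus l2 ->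
      act Q (tmul l1 l2) = tmul (act Q l1) (act Q l2)) /\
  (forall l, inTorus l -> act 1%:M l = l) /\
  (forall Q1 Q2 l, inGSp Q1 -> inGSp Q2 -> inTorus l ->
      act (Q1 *m Q2) l = act Q1 (act Q2 l)).

Definition inSD (p : 'M[int]_N * KN) : Prop := inGSp p.1 /\ inTorus p.2.
Definition sdmul (act : 'M[int]_N -> KN -> KN) (p q : 'M[int]_N * KN) :
  'M[int]_N * KN := (p.1 *m q.1, tmul p.2 (act p.1 q.2)).

End Hamiltonian.

Definition group_iso {A B : Type} (PA : A -> Prop) (mulA : A -> A -> A)
  (PB : B -> Prop) (mulB : B -> B -> B) : Prop :=
  exists f : A -> B,
    (forall a, PA a -> PB (f a)) /\
    (forall a b, PA a -> PA b -> f a = f b -> a = b) /\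
    (forall b, PB b -> exists2 a, PA a & f a = b) /\
    (forall a b, PA a -> PA b -> f (mulA a b) = mulB (f a) (f b)).

(* Main.v *)
(* An automorphism [sg] of [H'] conjugates the degree derivations [d_i] into
   derivations of [H'] that are still locally finite.  The component of degree
   [b <> 0] of any derivation of [H'] is a multiple [c_b] of [ad h_b], and finitely
   many [c_b] are nonzero.  If some were, a [b] of maximal Euclidean norm among them
   would be a vertex of the support, and the leading terms [(c_b ad h_b)^n h_r] would
   contradict local finiteness.  So the conjugated [d_i] are diagonal in the basis
   [h_r], hence [sg h_r = c_r h_(q r)].  The bracket relations make [q] additive, given
   by a matrix [Q]; since [Q] preserves orthogonality for the symplectic form, it is
   conformal, with multiplier [k = 1] or [-1], and [k c_r] is a character.
   Conversely the pair [(Q, l)] acts on the whole Witt algebra by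
   [D(u, r) |-> l^(Q r) D(Q^-T u, Q r)].  An automorphism of [H] preserves
   [H' = [H, H]] and is determined by its restriction, because the centralizer of
   [H'] in [H] vanishes. *)
Require Import Defs.
From Stdlib Require ClassicalEpsilon FunctionalExtensionality Classical_Prop.
From HB Require Import structures.
From mathcomp Require Import all_boot all_order all_algebra.
From mathcomp Require Import finmap ring zify.
From mathcomp.multinomials Require Import monalg.
Set Implicit Arguments. Unset Strict Implicit. Unset Printing Implicit Defensive.
Import Order.TTheory GRing.Theory Num.Theory.
Local Open Scope ring_scope.

(* Locked: unfolding graded sums during unification over ['cV[int]_n] does not
   terminate in practice. *)
HB.lock Definition gmap (I : choiceType) (V V' : zmodType) (A : I -> V -> V') (f : {malg V[I]})
  : {malg V'[I]} := [malg r in msupp f => A r f@_r].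

(** One construction serves two brackets: that of the Witt algebra, with coefficients in [KN], and
    the Poisson bracket [gpb], with coefficients in [K]. *)
HB.lock Definition gbr (I V V' V'' : zmodType) (beta : I -> I -> V -> V' -> V'')
  (f : {malg V[I]}) (g : {malg V'[I]}) : {malg V''[I]} :=
  \sum_(r <- msupp f) \sum_(s <- msupp g) << beta r s f@_r g@_s *g (r + s) >>.

(** * Graded additive maps and brackets on finitely supported families *)

Section GradedMaps.

Lemma malg_ind (I : choiceType) (V : zmodType) (A : {malg V[I]} -> Prop) :
  A 0 -> (forall r u, A << u *g r >>) ->
  (forall f g, A f -> A g -> A (f + g)) -> forall f, A f.
Proof. by move=> A0 AU AD f; rewrite [f]monalgE; elim/big_ind: _. Qed.

Lemma morphD0 (U V : zmodType) (F : U -> V) :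
  {morph F : x y / x + y} -> F 0 = 0.
Proof. by move=> FD; apply: (@addrI _ (F 0)); rewrite -FD !addr0. Qed.

Lemma morphDN (U V : zmodType) (F : U -> V) :
  {morph F : x y / x + y} -> {morph F : x / - x}.
Proof.
move=> FD x; apply: (@addrI _ (F x)).
by rewrite -FD !subrr morphD0.
Qed.

Lemma morphD_sum (U V : zmodType) (F : U -> V) (I : Type) (s : seq I) (G : I -> U) :
  {morph F : x y / x + y} -> F (\sum_(i <- s) G i) = \sum_(i <- s) F (G i).
Proof. by move=> FD; apply: (big_morph F FD); apply: morphD0. Qed.

Lemma malg_additive_ext (I : choiceType) (V U : zmodType) (F G : {malg V[I]} -> U) :
  {morph F : x y / x + y} -> {morph G : x y / x + y} ->
  (forall r u, F << u *g r >> = G << u *g r >>) -> F =1 G.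
Proof.
move=> FD GD FG; apply: malg_ind => // [|f g Ef Eg].
  by rewrite !morphD0.
by rewrite FD GD Ef Eg.
Qed.

Lemma gmapE (I : choiceType) (V V' : zmodType) (A : I -> V -> V') f r :
  A r 0 = 0 -> (gmap A f)@_r = A r f@_r.
Proof. by move=> A0; rewrite gmap.unlock mcoeffE; case: msuppP. Qed.

Lemma gmapU (I : choiceType) (V V' : zmodType) (A : I -> V -> V') r u :
  (forall r, A r 0 = 0) -> gmap A << u *g r >> = << A r u *g r >>.
Proof.
move=> A0; apply/malgP => k; rewrite gmapE // !mcoeffU.
by case: eqVneq => [->|_]; rewrite ?mulr1n // !mulr0n A0.
Qed.

Lemma gmapD (I : choiceType) (V V' : zmodType) (A : I -> V -> V') :
  (forall r, {morph A r : x y / x + y}) -> {morph gmap A : x y / x + y}.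
Proof.
move=> AD f g; apply/malgP => k.
by rewrite mcoeffD !gmapE ?mcoeffD ?AD //; apply: morphD0.
Qed.

Section GradedBracket.
Variables (I V V' V'' : zmodType) (beta : I -> I -> V -> V' -> V'').

Local Notation gbr := (gbr beta).

Hypothesis betaDl : forall r s v, {morph (beta r s)^~ v : x y / x + y}.
Hypothesis betaDr : forall r s u, {morph beta r s u : x y / x + y}.

Let beta0l r s v : beta r s 0 v = 0.
Proof. exact: (morphD0 (betaDl r s v)). Qed.

Let beta0r r s u : beta r s u 0 = 0.
Proof. exact: (morphD0 (betaDr r s u)). Qed.

Lemma gbrEw (d1 d2 : {fset I}) f g :
  (msupp f `<=` d1)%fset -> (msupp g `<=` d2)%fset ->
  gbr f g = \sum_(r <- d1) \sum_(s <- d2) << beta r s f@_r g@_s *g (r + s) >>.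
Proof.
move=> le1 le2; rewrite gbr.unlock (big_fset_incl _ le1) /=.
  apply/eq_bigr=> r _; apply/big_fset_incl => // s _ /mcoeff_outdom ->.
  by rewrite beta0r monalgU0.
move=> r _ /mcoeff_outdom fr; rewrite big1 // => s _.
by rewrite fr beta0l monalgU0.
Qed.

Lemma gbrDl g : {morph gbr^~ g : x y / x + y}.
Proof.
move=> f f' /=; pose d := (msupp f `|` msupp f')%fset.
rewrite !(@gbrEw d (msupp g)) ?fsubsetUl ?fsubsetUr ?msuppD_le ?fsubset_refl //.
rewrite -big_split; apply: eq_bigr => r _; rewrite -big_split; apply: eq_bigr => s _ /=.
by rewrite mcoeffD betaDl monalgUD.
Qed.

Lemma gbrDr f : {morph gbr f : x y / x + y}.
Proof.
move=> g g' /=; pose d := (msupp g `|` msupp g')%fset.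
rewrite !(@gbrEw (msupp f) d) ?fsubsetUl ?fsubsetUr ?msuppD_le ?fsubset_refl //.
rewrite -big_split; apply: eq_bigr => r _; rewrite -big_split; apply: eq_bigr => s _ /=.
by rewrite mcoeffD betaDr monalgUD.
Qed.

Lemma gbrUU u r v s : gbr << u *g r >> << v *g s >> = << beta r s u v *g (r + s) >>.
Proof.
by rewrite (gbrEw msuppU_le msuppU_le) !big_seq_fset1 !mcoeffUU.
Qed.

Lemma gbr_coefr f v s t : (gbr f << v *g s >>)@_t = beta (t - s) s f@_(t - s) v.
Proof.
move: f; apply: malg_additive_ext => [x y|x y|r u].
- by rewrite gbrDl mcoeffD.
- by rewrite mcoeffD betaDl.
rewrite gbrUU !mcoeffU; case: (eqVneq r (t - s)) => [->|ne].
  by rewrite subrK eqxx.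
rewrite mulr0n beta0l; case: eqP => // E; case/eqP: ne.
by rewrite -E addrK.
Qed.

Lemma gbr_coefl u r g t : (gbr << u *g r >> g)@_t = beta r (t - r) u g@_(t - r).
Proof.
move: g; apply: malg_additive_ext => [x y|x y|s v].
- by rewrite gbrDr mcoeffD.
- by rewrite mcoeffD betaDr.
rewrite gbrUU !mcoeffU; case: (eqVneq s (t - r)) => [->|ne].
  by rewrite [r + _]addrC subrK eqxx.
rewrite mulr0n beta0r; case: eqP => // E; case/eqP: ne.
by rewrite -E addrC addKr.
Qed.

Lemma gbr_ext (U : zmodType) (F G : {malg V[I]} -> {malg V'[I]} -> U) :
  (forall g, {morph F^~ g : x y / x + y}) -> (forall f, {morph F f : x y / x + y}) ->
  (forall g, {morph G^~ g : x y / x + y}) -> (forall f, {morph G f : x y / x + y}) ->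
  (forall r u s v, F << u *g r >> << v *g s >> = G << u *g r >> << v *g s >>) ->
  F =2 G.
Proof.
move=> FDl FDr GDl GDr E f g; move: f; apply: malg_additive_ext => [x y|x y|r u].
- exact: FDl.
- exact: GDl.
by move: g; apply: malg_additive_ext => [x y|x y|s v] //; [apply: FDr|apply: GDr].
Qed.

End GradedBracket.
End GradedMaps.

(** * The symplectic form on the lattice *)

Section Omega.
Variable m : nat.
Local Notation N := (m + m)%N.
Local Notation ZN := (ZN m).
Local Notation J := (Jmx m).
Implicit Types r s t : ZN.

(** The structure constant $(\overline r,s)$ of $[h_r,h_s]$, kept integral so that size and
    divisibility arguments apply. *)
Definition omega r s : int := ((J *m r)^T *m s) 0 0.
Definition zdelta (i : 'I_N) : ZN := delta_mx i 0.

Lemma trJ : J^T = - J.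
Proof.
by rewrite /Jmx tr_block_mx !linearN /= trmx1 !linear0 opp_block_mx !oppr0 opprK.
Qed.

Lemma JJ : J *m J = - 1%:M.
Proof.
rewrite /Jmx mulmx_block !mul0mx !mulmx0 mulNmx !mul1mx !addr0 add0r.
by rewrite [1%:M in RHS]scalar_mx_block opp_block_mx oppr0.
Qed.

Lemma J_inj : injective (mulmx J : ZN -> ZN).
Proof. by move=> r s /(congr1 (mulmx J)); rewrite !mulmxA JJ !mulNmx !mul1mx => /oppr_inj. Qed.

Lemma omegaDl t : {morph omega^~ t : r s / r + s}.
Proof. by move=> r s; rewrite /omega mulmxDr linearD mulmxDl mxE. Qed.
Lemma omegaDr r : {morph omega r : s t / s + t}.
Proof. by move=> s t; rewrite /omega mulmxDr mxE. Qed.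
Lemma omegaZl k r s : omega (k *: r) s = k * omega r s.
Proof. by rewrite /omega -scalemxAr linearZ /= -scalemxAl mxE. Qed.
Lemma omegaZr k r s : omega r (k *: s) = k * omega r s.
Proof. by rewrite /omega -scalemxAr mxE. Qed.
Lemma omegaNl r s : omega (- r) s = - omega r s.
Proof. by rewrite -scaleN1r omegaZl mulN1r. Qed.
Lemma omegaNr r s : omega r (- s) = - omega r s.
Proof. by rewrite -scaleN1r omegaZr mulN1r. Qed.
Lemma omega0l s : omega 0 s = 0.
Proof. by rewrite -(scale0r 0) omegaZl mul0r. Qed.
Lemma omega0r s : omega s 0 = 0.
Proof. by rewrite -(scale0r 0) omegaZr mul0r. Qed.

Lemma omegaC r s : omega s r = - omega r s.
Proof.
have tr11 (A : 'M[int]_1) : A 0 0 = A^T 0 0 by rewrite [RHS]mxE.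
rewrite /omega [in LHS]tr11 !trmx_mul trmxK trJ mulmxN mulNmx.
by rewrite mulmxA [in RHS]mxE opprK trmxK.
Qed.

Lemma omegaxx r : omega r r = 0.
Proof. by move: (omega r r) (omegaC r r) => x; lia. Qed.

Lemma omega_delta r i : omega r (zdelta i) = (J *m r) i 0.
Proof.
rewrite /omega mxE (bigD1 i) //= big1 ?addr0 => [|j /negbTE nj].
  by rewrite !mxE !eqxx mulr1.
by rewrite [zdelta i j 0]mxE nj mulr0.
Qed.

Lemma zn_neq0 r : r != 0 -> exists i, r i 0 != 0.
Proof.
move=> /eqP r0; apply/existsP; rewrite -[X in is_true X]negbK negb_exists.
apply/negP => /forallP H; apply: r0; apply/matrixP => i j.
by rewrite ord1 mxE; have := H i; rewrite negbK => /eqP.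
Qed.

Lemma omega_nondeg r : r != 0 -> exists i, omega r (zdelta i) != 0.
Proof.
move=> r0; have [|i Hi] := @zn_neq0 (J *m r); last by exists i; rewrite omega_delta.
by apply: contra_neq r0 => E; apply: J_inj; rewrite E mulmx0.
Qed.

(** Finitely many hyperplanes do not cover the lattice. This supplies the auxiliary vectors that
    reduce degenerate pairs to nondegenerate ones. *)
Lemma omega_avoid (vs : seq ZN) :
  {in vs, forall v, v != 0} -> exists t, {in vs, forall v, omega v t != 0}.
Proof.
elim: vs => [|v vs IH] nz; first by exists 0.
case: IH => [w Hw|t Ht]; first by apply: nz; rewrite inE Hw orbT.
have [s Hs] : exists s, omega v s != 0.
  by have [|i Hi] := @omega_nondeg v; [apply: nz; rewrite inE eqxx|exists (zdelta i)].
(* If [t] fails for [v], pass to [M t + s]: the term [s] repairs [v], and [M] exceeds every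
   [|omega w s|], so the nonzero integers [M * omega w t] cannot be cancelled. *)
have [|vt0] := boolP (omega v t != 0).
  by move=> vt; exists t => w; rewrite inE => /predU1P[->|/Ht].
pose M : int := 1 + \sum_(w <- vs) `|omega w s|.
exists (M *: t + s) => w; rewrite inE omegaDr omegaZr => /predU1P[->|wvs].
  by rewrite (eqP (negbNE vt0)) mulr0 add0r.
have := Ht _ wvs.
have ltM : `|omega w s| < M.
  rewrite /M (big_rem w) //=.
  have : 0 <= \sum_(y <- rem w vs) `|omega y s| by apply: sumr_ge0.
  move: (\sum_(y <- rem w vs) _) (omega w s) => S x; lia.
move: (omega w t) (omega w s) M ltM => x y M ltM x0.
apply/negP => /eqP E.
have : `|M * x| = `|y| by rewrite (_ : M * x = - y) ?normrN //; lia.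
rewrite normrM => {}E; have M0 : 0 <= M by lia.
by rewrite (ger0_norm M0) in E; nia.
Qed.

Lemma omega_avoid3 v1 v2 v3 : v1 != 0 -> v2 != 0 -> v3 != 0 ->
  exists t, [/\ omega v1 t != 0, omega v2 t != 0 & omega v3 t != 0].
Proof.
move=> h1 h2 h3; case: (@omega_avoid [:: v1; v2; v3]) => [v|t Ht].
  by rewrite !inE => /or3P[] /eqP->.
by exists t; split; apply: Ht; rewrite !inE eqxx ?orbT.
Qed.

End Omega.

Section OmegaK.
Variables (K : fieldType) (m : nat).
Hypothesis charK : [pchar K] =i pred0.
Local Notation ZN := (ZN m).

Lemma intr_eq0_pchar0 (z : int) : (z%:~R == 0 :> K) = (z == 0).
Proof.
have natK n : (n%:R == 0 :> K) = (n == 0%N) by have /pcharf0P -> := charK.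
case: z => n; first by rewrite -pmulrn natK.
by rewrite NegzE mulrNz oppr_eq0 -pmulrn natK.
Qed.

Lemma intr_inj_pchar0 : injective (fun z : int => z%:~R : K).
Proof.
by move=> x y /eqP; rewrite -subr_eq0 -rmorphB /= intr_eq0_pchar0 subr_eq0 => /eqP.
Qed.

Lemma dotZ_rbar (r s : ZN) : dotZ (rbarK K r) s = (omega r s)%:~R.
Proof.
rewrite /dotZ /omega mxE rmorph_sum; apply: eq_bigr => i _.
by rewrite !mxE rmorphM.
Qed.

Lemma dotZDl (s : ZN) : {morph (@dotZ K m)^~ s : u v / u + v}.
Proof.
by move=> u v; rewrite /dotZ -big_split; apply: eq_bigr => i _; rewrite mxE mulrDl.
Qed.

Lemma dotZDr (u : KN K m) : {morph @dotZ K m u : r s / r + s}.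
Proof.
by move=> r s; rewrite /dotZ -big_split; apply: eq_bigr => i _; rewrite mxE rmorphD mulrDr.
Qed.

Lemma dotZZl a (u : KN K m) (s : ZN) : dotZ (a *: u) s = a * dotZ u s.
Proof. by rewrite /dotZ mulr_sumr; apply: eq_bigr => i _; rewrite mxE mulrA. Qed.

Lemma dotZ_mx (u : KN K m) (s : ZN) :
  dotZ u s = (u^T *m map_mx (fun z : int => z%:~R : K) s) 0 0.
Proof. by rewrite /dotZ mxE; apply: eq_bigr => i _; rewrite !mxE. Qed.

Lemma rbarK0 : rbarK K (0 : ZN) = 0.
Proof. by apply/matrixP => i j; rewrite /rbarK mulmx0 !mxE. Qed.

Lemma rbarKD : {morph @rbarK K m : r s / r + s}.
Proof. by move=> r s; rewrite /rbarK mulmxDr map_mxD. Qed.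

Lemma rbarK_eq0 (r : ZN) : (rbarK K r == 0) = (r == 0).
Proof.
apply/eqP/eqP => [E|->]; last exact: rbarK0.
apply/eqP; apply: contraT => /omega_nondeg[i]; rewrite -(intr_eq0_pchar0) -dotZ_rbar E.
by rewrite -(scale0r 0) dotZZl mul0r eqxx.
Qed.

End OmegaK.

(** * Homogeneous derivations *)

Section ShiftEquation.
Variables (K : fieldType) (m : nat).
Hypothesis charK : [pchar K] =i pred0.
Local Notation ZN := (ZN m).
Implicit Types r s t b : ZN.

Definition wK r s : K := (omega r s)%:~R.

Lemma wKDl t : {morph wK^~ t : r s / r + s}.
Proof. by move=> r s; rewrite /wK omegaDl rmorphD. Qed.
Lemma wKDr r : {morph wK r : s t / s + t}.
Proof. by move=> s t; rewrite /wK omegaDr rmorphD. Qed.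
Lemma wKNl r s : wK (- r) s = - wK r s.
Proof. by rewrite /wK omegaNl rmorphN. Qed.
Lemma wKNr r s : wK r (- s) = - wK r s.
Proof. by rewrite /wK omegaNr rmorphN. Qed.
Lemma wK0l s : wK 0 s = 0. Proof. by rewrite /wK omega0l. Qed.
Lemma wK0r s : wK s 0 = 0. Proof. by rewrite /wK omega0r. Qed.
Lemma wKxx r : wK r r = 0. Proof. by rewrite /wK omegaxx. Qed.
Lemma wKC r s : wK s r = - wK r s.
Proof. by rewrite /wK omegaC rmorphN. Qed.
Lemma wK_eq0 r s : (wK r s == 0) = (omega r s == 0).
Proof. exact: intr_eq0_pchar0. Qed.

Definition wKE := (wKDl, wKDr, wKNl, wKNr, wKxx, wK0l, wK0r).

(* The defining equation says that [h_r |-> phi r *: h_(r+b)] is a derivation,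
   the conclusion that it is a multiple of [ad h_b]. *)
Lemma shift_derivation_inner b (phi : ZN -> K) :
  b != 0 -> phi (- b) = 0 ->
  (forall r s, wK r s * phi (r + s) = wK (r + b) s * phi r + wK r (s + b) * phi s) ->
  exists c, forall r, phi r = c * wK b r.
Proof.
move=> b0 phiNb eqn.
(* Put [s = - b]: the second term on the right vanishes, so [phi] is [b]-periodic off the hyperplane
   orthogonal to [b]. *)
have phi_per r : wK b r != 0 -> phi (r - b) = phi r.
  move=> br; have := eqn r (- b); rewrite phiNb mulr0 addr0 !wKE (wKC b r) ?oppr0 ?addr0 ?opprK.
  exact: mulfI.
(* Subtract the equation at [(r - b, s)] from the one at [(r, s)]; by periodicity only [wK b s]
   times the additivity defect survives. *)
have phiD r s : wK b r != 0 -> wK b s != 0 -> wK b (r + s) != 0 ->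
    phi (r + s) = phi r + phi s.
  move=> br bs brs; have e1 := eqn r s.
  have := eqn (r - b) s; rewrite addrAC phi_per // phi_per // subrK => e2.
  apply: (mulfI bs); move: e1 e2; rewrite !wKE => e1 e2.
  have -> : wK b s * phi (r + s) =
    wK r s * phi (r + s) - (wK r s + - wK b s) * phi (r + s) by ring.
  by rewrite e2 e1; ring.
(* Additivity turns the equation into proportionality of [phi] and [wK b]. *)
have cross r s : wK b r != 0 -> wK b s != 0 -> wK b (r + s) != 0 ->
    wK b s * phi r = wK b r * phi s.
  move=> br bs brs; have := eqn r s; rewrite phiD // !wKE (wKC b r) => e.
  apply/eqP; rewrite -subr_eq0; apply/eqP.
  transitivity ((wK r s + wK b s) * phi r + (wK r s - wK b r) * phi s
    - wK r s * (phi r + phi s)); first by ring.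
  by rewrite e; ring.
have [i] := omega_nondeg b0; set s0 := zdelta i; rewrite -wK_eq0 => bs0.

pose c := phi s0 / wK b s0.
have two0 : (2%:R : K) != 0.
  by have := intr_eq0_pchar0 charK 2; rewrite -pmulrn => ->.
have phi1 r : wK b r != 0 -> phi r = c * wK b r.
  move=> br; rewrite /c mulrAC; apply: (canRL (mulfK bs0)); rewrite mulrC [RHS]mulrC.
  have [brs0|/negPf/negbT] := boolP (wK b (r + s0) != 0).
    by rewrite cross.
  rewrite negbK => /eqP e.
  (* Here [r + s0] is orthogonal to [b], so [s0] is replaced by [2 s0], for which
     [wK b (r + 2 s0) = wK b s0]. *)
  have b2 : wK b (s0 + s0) = 2%:R * wK b s0 by rewrite wKDr; ring.
  have b20 : wK b (s0 + s0) != 0 by rewrite b2 mulf_neq0.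
  have := @cross r (s0 + s0) br b20; rewrite phiD // b2.
  have -> : wK b (r + (s0 + s0)) = wK b s0 by rewrite addrA wKDr e add0r.
  move=> /(_ bs0) e'; apply: (mulfI two0).
  by rewrite mulrA e'; ring.
exists c => r; have [br|/negPn/eqP br] := boolP (wK b r != 0); first exact: phi1.
rewrite br mulr0.
have [->//|rb] := eqVneq r (- b).
(* Now [wK b r = 0]. With [s] nonorthogonal to [b] and to [r + b], the terms in [phi s] cancel and
   [wK (r + b) s * phi r = 0] remains. *)
have rb0 : r + b != 0 by rewrite addr_eq0.
have [s [bs rbs _]] := omega_avoid3 b0 rb0 rb0.
rewrite -wK_eq0 in bs; rewrite -wK_eq0 in rbs.
have := eqn r s.
have -> : phi (r + s) = phi s by rewrite !phi1 // wKDr br add0r.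
rewrite [wK r (s + b)]wKDr (wKC b r) br oppr0 addr0 => e.
apply: (mulfI rbs); rewrite mulr0.
by apply: (addIr (wK r s * phi s)); rewrite add0r -e.
Qed.

End ShiftEquation.

(** * Extremal elements and the Euclidean norm on the lattice *)

Lemma seq_argmax (T : eqType) (f : T -> int) (s : seq T) (x0 : T) :
  x0 \in s -> exists2 x, x \in s & {in s, forall y, f y <= f x}.
Proof.
elim: s x0 => // a s IH x0 _.
case: s IH => [|b s] IH; first by exists a; rewrite ?inE // => y /[!inE] /eqP->.
have [x xs xM] := IH b (mem_head _ _).
have [le|lt] := leP (f a) (f x).
  by exists x; [rewrite inE xs orbT | move=> y; rewrite inE => /predU1P[->|/xM]].
exists a; [exact: mem_head | move=> y; rewrite inE => /predU1P[->//|/xM le]].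
exact: le_trans le (ltW lt).
Qed.

Lemma malgUZ (I : choiceType) (R : nzRingType) (a : R) (r : I) :
  << a *g r >> = a *: << r >> :> {malg R[I]}.
Proof.
by apply/malgP => k; rewrite mcoeffZ !mcoeffU mulrnAr mulr1.
Qed.

Section LatticeNorm.
Variable n : nat.
Implicit Types x y z : 'cV[int]_n.

Definition zdot x y : int := \sum_i x i 0 * y i 0.

Lemma zdotDr x : {morph zdot x : y z / y + z}.
Proof. by move=> y z; rewrite -big_split; apply: eq_bigr => i _; rewrite mxE mulrDr. Qed.

Lemma zdot_gt0 x : x != 0 -> 0 < zdot x x.
Proof.
move=> x0; rewrite lt_neqAle eq_sym psumr_eq0 => [|i _]; last by rewrite -expr2 sqr_ge0.
rewrite sumr_ge0 ?andbT => [|i _]; last by rewrite -expr2 sqr_ge0.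
apply: contra x0 => /allP H; apply/eqP/matrixP => i j; rewrite ord1 mxE; apply/eqP.
by have := H i; rewrite mem_index_enum mulf_eq0 orbb => /(_ isT).
Qed.

(* Expand [0 < |x - y|^2]. *)
Lemma zdot_max x y : y != x -> zdot y y <= zdot x x -> zdot x y < zdot x x.
Proof.
move=> yx le; have : x - y != 0 by rewrite subr_eq0 eq_sym.
move=> /zdot_gt0; have -> : zdot (x - y) (x - y) = zdot x x - 2 * zdot x y + zdot y y.
  rewrite /zdot mulr_sumr -sumrB -big_split; apply: eq_bigr => i _.
  by rewrite !mxE /=; ring.
by lia.
Qed.

End LatticeNorm.

(* For [w = wK], [<<r>>] stands for [h_r]; the extra basis vector [<<0>>] is central. *)
Section GradedPoisson.
Variables (K : fieldType) (I : zmodType) (w : I -> I -> K).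
Local Notation L := {malg K[I]}.
Implicit Types (r s t : I) (f g : L).

Definition gpb : L -> L -> L := gbr (fun r s a c => w r s * a * c).

Definition lin (F : L -> L) :=
  {morph F : f g / f + g} /\ forall a f, F (a *: f) = a *: F f.

(** For additive [theta] this is a derivation; the [i]-th coordinate as [theta] gives the action of
    $d_i$. *)
Definition gwt (theta : I -> K) : L -> L := gmap (fun r a => theta r * a).

Let pbB1 r s (c : K) : {morph (fun a => w r s * a * c) : a a' / a + a'}.
Proof. by move=> a a'; rewrite mulrDr mulrDl. Qed.
Let pbB2 r s (a : K) : {morph (fun c => w r s * a * c) : c c' / c + c'}.
Proof. by move=> c c'; rewrite mulrDr. Qed.

Lemma gpbDl g : {morph gpb^~ g : f f' / f + f'}. Proof. exact: gbrDl. Qed.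
Lemma gpbDr f : {morph gpb f : g g' / g + g'}. Proof. exact: gbrDr. Qed.
Lemma gpbUU a r c s : gpb << a *g r >> << c *g s >> = << w r s * a * c *g (r + s) >>.
Proof. exact: gbrUU. Qed.
Lemma gpb_coefr f c s t : (gpb f << c *g s >>)@_t = w (t - s) s * f@_(t - s) * c.
Proof. exact: gbr_coefr. Qed.
Lemma gpb_coefl a r g t : (gpb << a *g r >> g)@_t = w r (t - r) * a * g@_(t - r).
Proof. exact: gbr_coefl. Qed.

Lemma lin_coef F f t : lin F -> (F f)@_t = \sum_(s <- msupp f) f@_s * (F << s >>)@_t.
Proof.
case=> FD FZ; rewrite {1}[f]monalgE morphD_sum // raddf_sum; apply: eq_bigr => s _ /=.
by rewrite malgUZ FZ mcoeffZ.
Qed.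

Lemma lin_coef_neq0 F f t : lin F -> (F f)@_t != 0 ->
  exists2 s, s \in msupp f & (F << s >>)@_t != 0.
Proof.
move=> lF; rewrite (lin_coef _ _ lF) => nz; apply/hasP; apply: contraNT nz => /hasPn H.
rewrite big_seq big1 // => s /H; rewrite negbK => /eqP->; exact: mulr0.
Qed.

Lemma gwtE theta f r : (gwt theta f)@_r = theta r * f@_r.
Proof. by rewrite gmapE ?mulr0. Qed.

Lemma gwt_lin theta : lin (gwt theta).
Proof.
split=> [f g|a f]; apply/malgP => k.
  by rewrite [RHS]mcoeffD !gwtE mcoeffD mulrDr.
by rewrite gwtE [RHS]mcoeffZ gwtE mcoeffZ mulrCA.
Qed.

Lemma gwtU theta a r : gwt theta << a *g r >> = << theta r * a *g r >>.
Proof. by rewrite /gwt gmapU // => s; rewrite mulr0. Qed.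

Lemma gwt_pb theta f g : {morph theta : r s / r + s} ->
  gwt theta (gpb f g) = gpb (gwt theta f) g + gpb f (gwt theta g).
Proof.
move=> thetaD; have [wD _] := gwt_lin theta; move: f g; apply: gbr_ext.
- by move=> g x y /=; rewrite gpbDl wD.
- by move=> f x y /=; rewrite gpbDr wD.
- by move=> g x y /=; rewrite (wD x y) !gpbDl; exact: addrACA.
- by move=> f x y /=; rewrite (wD x y) !gpbDr; exact: addrACA.
move=> r u s v; rewrite !(gpbUU, gwtU) -monalgUD thetaD.
by congr (<< _ *g _ >>); ring.
Qed.

Section Center.
Hypothesis w0l : forall s, w 0 s = 0.
Hypothesis w0r : forall s, w s 0 = 0.

Lemma gpb_const f g a : gpb (f - << a *g 0 >>) g = gpb f g.
Proof.
rewrite (gpbDl g) -monalgUN -[RHS]addr0; congr (_ + _).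
by apply/malgP => t; rewrite gpb_coefl w0l !mul0r mcoeff0.
Qed.

Lemma gpb_constr f g a : gpb f (g - << a *g 0 >>) = gpb f g.
Proof.
rewrite (gpbDr f) -monalgUN -[RHS]addr0; congr (_ + _).
by apply/malgP => t; rewrite gpb_coefr w0r !mul0r mcoeff0.
Qed.

End Center.
End GradedPoisson.

(** * Derivations of the Poisson algebra of the torus *)

Section TorusPoisson.
Variables (K : fieldType) (m : nat).
Hypothesis charK : [pchar K] =i pred0.
Local Notation ZN := (ZN m).
Local Notation L := {malg K[ZN]}.
Local Notation wK := (@wK K m).
Implicit Types (r s t b : ZN) (f g : L).

Local Notation pb := (gpb wK).

(** The degree-[b] component of the Leibniz rule for [<<r>>] and [<<s>>] is the equation of
    [shift_derivation_inner]; the vanishing constant term of [D] supplies [phi (- b) = 0]. *)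
Lemma derivation_shift (D : L -> L) : lin D ->
  (forall f g, D (pb f g) = pb (D f) g + pb f (D g)) -> (forall f, (D f)@_0 = 0) ->
  forall b, b != 0 -> exists c, forall r, (D << r >>)@_(r + b) = c * wK b r.
Proof.
move=> [DD DZ] Dpb D0 b b0.
apply: (shift_derivation_inner charK b0 (phi := fun r => (D << r >>)@_(r + b))) => [|r s].
  by rewrite addNr D0.
have := congr1 (fun f => f@_(r + s + b)) (Dpb << r >> << s >>).
rewrite gpbUU malgUZ DZ mcoeffZ mcoeffD gpb_coefr gpb_coefl !mulr1.
by have [-> ->] : r + s + b - s = r + b /\ r + s + b - r = s + b
  by split; rewrite addrAC ?addrK // (addrC r) addrK.
Qed.

Lemma locally_finite_diagonal (D : L -> L) : lin D ->
  (forall b, b != 0 -> exists c, forall r, (D << r >>)@_(r + b) = c * wK b r) ->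
  (forall r, r != 0 -> exists S : seq ZN,
     forall n t, (iter n D << r >>)@_t != 0 -> t \in S) ->
  forall r t, t != r -> (D << r >>)@_t = 0.
Proof.
move=> lD shiftD finD r1 t1 t1r1; apply/eqP; apply: contraT => nz1.
(* [B] contains every nonzero degree of [D]: a nonzero multiple of [ad h_b] already moves some
   [<<zdelta i>>], so finitely many test vectors suffice. *)
pose B := [seq b <- flatten [seq [seq t - zdelta i | t <- msupp (D << zdelta i >>)]
   | i <- enum 'I_(m + m)] | b != 0].
have memB b r : b != 0 -> (D << r >>)@_(r + b) != 0 -> b \in B.
  move=> b0; have [c Hc] := shiftD b b0; rewrite Hc mulf_eq0 negb_or => /andP[c0 _].
  rewrite mem_filter b0; have [i] := omega_nondeg b0; rewrite -(wK_eq0 charK) => bi.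
  apply/flattenP; exists [seq t - zdelta i | t <- msupp (D << zdelta i >>)].
    by apply: map_f; rewrite mem_enum.
  apply/mapP; exists (zdelta i + b); last by rewrite addrAC subrr add0r.
  by rewrite -mcoeff_neq0 Hc mulf_neq0.
have b1B : t1 - r1 \in B.
  by apply: (@memB _ r1); [rewrite subr_eq0 | rewrite addrC subrK].
(* By maximality of its norm, [b0] is the unique maximum of [zdot b0] on [B]. *)
have [b0 b0B b0max] := seq_argmax (fun b => zdot b b) b1B.
have [b0nz [i Hi]] : b0 != 0 /\ exists i, (D << zdelta i >>)@_(zdelta i + b0) != 0.
  move: b0B; rewrite mem_filter => /andP[-> /flattenP[_ /mapP[i _ ->] /mapP[t tD ->]]].
  by split=> //; exists i; rewrite addrC subrK mcoeff_neq0.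
have [c Hc] := shiftD b0 b0nz.
move: Hi; rewrite Hc mulf_eq0 negb_or => /andP[c0 w0].
set r := zdelta i in w0.
have r0 : r != 0 by apply: contraNneq w0 => ->; rewrite wK0r.
have ltB b : b \in B -> b != b0 -> zdot b0 b < zdot b0 b0.
  by move=> bB bb0; apply: zdot_max => //; apply: b0max.
have pos : 0 < zdot b0 b0 by apply: zdot_gt0.
(* Any component of [D] of degree other than [b0] raises [zdot b0] by less than [zdot b0 b0]. *)
have step s t : (D << s >>)@_t != 0 -> t != s + b0 ->
    zdot b0 t < zdot b0 s + zdot b0 b0.
  move=> nz ne; have -> : t = s + (t - s) by rewrite addrC subrK.
  rewrite zdotDr ltrD2l; have [->|ts] := eqVneq t s.
    by rewrite subrr (morphD0 (zdotDr b0)).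
  apply: ltB; last by rewrite subr_eq addrC.
  by apply: (@memB _ s); [rewrite subr_eq0 | rewrite addrC subrK].
(* The extremal coefficient is multiplied by the same scalar each time, because
   [wK b0 (r + b0 *+ n) = wK b0 r]; everything else stays strictly lower. *)
have key n : (iter n D << r >>)@_(r + b0 *+ n) = (c * wK b0 r) ^+ n /\
    forall t, (iter n D << r >>)@_t != 0 -> t != r + b0 *+ n ->
      zdot b0 t < zdot b0 (r + b0 *+ n).
  elim: n => [|n [IH1 IH2]].
    rewrite mulr0n addr0 expr0 [iter 0 _ _]/(<< r >>).
    split=> [|t]; first exact: mcoeffUU.
    by rewrite mcoeffU (eq_sym r); case: (t == r) => // /eqP.
  rewrite iterS; set f := iter n D _ in IH1 IH2 *; set s := r + b0 *+ n in IH1 IH2 *.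
  have sS : r + b0 *+ n.+1 = s + b0 by rewrite mulrSr addrA.
  have ws : wK b0 s = wK b0 r.
    by rewrite /s wKDr; elim: (n) => [|k IH]; rewrite ?mulr0n ?wK0r ?addr0 // mulrSr wKDr wKxx addr0.
  rewrite sS; split=> [|t].
    have sf : s \in msupp f by rewrite -mcoeff_neq0 IH1 expf_neq0 // mulf_neq0.
    rewrite (lin_coef _ _ lD) (big_fsetD1 s) //= IH1 Hc ws -exprSr.
    rewrite big_seq big1 ?addr0 // => s'; rewrite !inE -mcoeff_neq0 => /andP[ne s'f].
    apply/eqP; rewrite mulf_eq0 orbC; apply/orP; left; apply: contraT => nz.
    have := IH2 _ s'f ne; have := step _ _ nz; rewrite (inj_eq (addIr b0)) eq_sym => /(_ ne).
    by rewrite zdotDr ltrD2r => h1 h2; have := lt_trans h1 h2; rewrite ltxx.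
  move=> nz ne; have [s' s'f nz'] := lin_coef_neq0 lD nz.
  rewrite -mcoeff_neq0 in s'f; rewrite zdotDr.
  have [E|ss'] := eqVneq s' s; first by rewrite -E in ne *; exact: step.
  have lt1 := IH2 _ s'f ss'.
  have [->|ne'] := eqVneq t (s' + b0); first by rewrite zdotDr ltrD2r.
  by apply: lt_trans (step _ _ nz' ne') _; rewrite ltrD2r.
have [S HS] := finD r r0.
have injr : injective (fun n : nat => r + b0 *+ n).
  move=> n1 n2 /addrI E; have := congr1 (zdot b0) E.
  have ex n : zdot b0 (b0 *+ n) = zdot b0 b0 *+ n.
    elim: n => [|n IH]; rewrite ?mulr0n ?(morphD0 (zdotDr b0)) //.
    by rewrite !mulrS zdotDr IH.
  by rewrite !ex => /eqP; rewrite eq_le !(ler_pMn2l pos) -eqn_leq => /eqP.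
(* Pigeonhole: [(size S).+1] distinct degrees would lie in [S]. *)
have := @uniq_leq_size _ [seq r + b0 *+ n | n <- iota 0 (size S).+1] S.
rewrite map_inj_uniq // iota_uniq size_map size_iota ltnn; apply=> // t /mapP[n _ ->].
by apply: (HS n); case: (key n) => -> _; rewrite expf_neq0 // mulf_neq0.
Qed.

End TorusPoisson.

(** * Conjugated degree derivations *)

Section MutuallyInverse.
Variables (K : fieldType) (I : zmodType) (w : I -> I -> K).
Local Notation L := {malg K[I]}.
Local Notation pb := (gpb w).
Implicit Types (r s t : I) (f g : L).

Definition noconst f : L := f - << f@_0 *g 0 >>.

(* [sg] and [ta] are mutually inverse automorphisms of the quotient of [L] by its
   center, realized on the complement spanned by the [<<r>>] with [r != 0]. *)
Definition lie_inverse (sg ta : L -> L) : Prop :=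
  [/\ lin sg, (forall f g, sg (pb f g) = pb (sg f) (sg g)),
      (forall f, (sg f)@_0 = 0) & (forall f, sg (ta f) = noconst f)].

Variables sg ta : L -> L.
Hypothesis sgta : lie_inverse sg ta.
Hypothesis tasg : lie_inverse ta sg.
Hypothesis w0l : forall s, w 0 s = 0.
Hypothesis w0r : forall s, w s 0 = 0.
Variable theta : I -> K.
Hypothesis thetaD : {morph theta : r s / r + s}.

Definition conj_wt f : L := sg (gwt theta (ta f)).

Lemma noconstU r : r != 0 -> noconst << r >> = << r >>.
Proof. by move=> r0; rewrite /noconst mcoeffU (negPf r0) monalgU0 subr0. Qed.

Lemma noconst_id f : f@_0 = 0 -> noconst f = f.
Proof. by move=> f0; rewrite /noconst f0 monalgU0 subr0. Qed.

Lemma gwt0 f : (gwt theta f)@_0 = 0.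
Proof. by rewrite gwtE (morphD0 thetaD) mul0r. Qed.

Lemma gwt_noconst f : gwt theta (noconst f) = gwt theta f.
Proof.
apply/malgP => k; rewrite !gwtE mcoeffB mcoeffU.
by case: eqVneq => [<-|_]; rewrite ?subr0 // (morphD0 thetaD) !mul0r.
Qed.

Lemma conj_wt_lin : lin conj_wt.
Proof.
have [[sD sZ] _ _ _] := sgta; have [[tD tZ] _ _ _] := tasg; have [wD wZ] := gwt_lin theta.
by split=> [f g|a f]; rewrite /conj_wt ?tD ?wD ?sD // tZ wZ sZ.
Qed.

(** [sg] undoes [ta] only up to a multiple of [<<0>>], which brackets do not see. *)
Lemma conj_wt_pb f g : conj_wt (pb f g) = pb (conj_wt f) g + pb f (conj_wt g).
Proof.
have [[sD _] sP _ sK] := sgta; have [_ tP _ _] := tasg.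
by rewrite /conj_wt tP gwt_pb // sD !sP !sK gpb_const // gpb_constr.
Qed.

Lemma conj_wt_iter r n : r != 0 ->
  iter n conj_wt << r >> = sg (iter n (gwt theta) (ta << r >>)).
Proof.
move=> r0; have [_ _ _ sK] := sgta; have [_ _ _ tK] := tasg.
elim: n => [|n IH]; first by rewrite sK noconstU.
by rewrite !iterS IH /conj_wt tK gwt_noconst.
Qed.

(** [gwt] never enlarges a support, so every iterate lies in the span of the [sg <<s>>] with [s] in
    the support of [ta <<r>>]. *)
Lemma conj_wt_locally_finite r : r != 0 ->
  exists S : seq I, forall n t, (iter n conj_wt << r >>)@_t != 0 -> t \in S.
Proof.
move=> r0; have [sL _ _ _] := sgta.
exists (flatten [seq (msupp (sg << s >>) : seq I) | s <- msupp (ta << r >>)]) => n t.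
rewrite conj_wt_iter // => /(lin_coef_neq0 sL)[s].
rewrite -mcoeff_neq0 => ws st; apply/flattenP; exists (msupp (sg << s >>) : seq I); last first.
  by rewrite -mcoeff_neq0.
apply: map_f; rewrite -mcoeff_neq0; apply: contraNneq ws => s0.
by elim: n => [|n IH]; rewrite ?iterS ?gwtE ?s0 // (eqP IH) mulr0.
Qed.

(** Applying [ta] makes [ta <<r>>] an eigenvector of the diagonal map [gwt theta], which confines
    its support to one level set of [theta]. *)
Lemma conj_wt_eigen r a : conj_wt << r >> = << a *g r >> ->
  forall s, s \in msupp (ta << r >>) -> theta s = a.
Proof.
have [_ _ _ sK] := sgta; have [[_ tZ] _ t0 tK] := tasg.
move=> /(congr1 ta); rewrite /conj_wt tK noconst_id ?gwt0 // (malgUZ a) tZ => E s.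
rewrite -mcoeff_neq0 => nz; apply: (mulIf nz).
by rewrite -gwtE E mcoeffZ.
Qed.

End MutuallyInverse.

Section MonomialImages.
Variables (K : fieldType) (m : nat).
Hypothesis charK : [pchar K] =i pred0.
Local Notation ZN := (ZN m).
Local Notation L := {malg K[ZN]}.
Local Notation wK := (@wK K m).
Implicit Types (r s t b : ZN) (f g : L).

(** With [theta] ranging over all coordinates, the conjugated degree derivations are diagonal, so
    every coordinate is constant on the support of [ta <<r>>]; this support is then a single
    point. *)
Lemma lie_inverse_monomial (sg ta : L -> L) :
  lie_inverse wK sg ta -> lie_inverse wK ta sg ->
  forall r, r != 0 -> exists a s, [/\ a != 0, s != 0 & ta << r >> = << a *g s >>].
Proof.
move=> sgta tasg r r0.
have w0l := @wK0l K m; have w0r := @wK0r K m.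
have thetaD i : {morph (fun r : ZN => (r i 0)%:~R : K) : r s / r + s}.
  by move=> x y; rewrite mxE rmorphD.
have eig i : exists a : K, forall s, s \in msupp (ta << r >>) -> (s i 0)%:~R = a.
  pose D := conj_wt sg ta (fun r : ZN => (r i 0)%:~R : K).
  exists (D << r >>)@_r; apply: (conj_wt_eigen sgta tasg (thetaD i)).
  apply/malgP => t; rewrite mcoeffU; have [<-//|tr] := eqVneq r t.
  rewrite eq_sym in tr.
  apply: (locally_finite_diagonal charK (D := D)) => //; first exact: (conj_wt_lin sgta tasg).
    apply: derivation_shift => //; first exact: (conj_wt_lin sgta tasg).
      by move=> f g; apply: (conj_wt_pb sgta tasg).
    by move=> f; have [_ _ s0 _] := sgta; apply: s0.
  by move=> r' r'0; apply: (conj_wt_locally_finite sgta tasg).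
have [sL _ s0 sK] := sgta; have [_ _ t0 _] := tasg.
have nz : ta << r >> != 0.
  apply/eqP => E; have := sK << r >>; rewrite E noconstU //.
  rewrite (morphD0 sL.1) => /(congr1 (mcoeff r)); rewrite mcoeff0 mcoeffUU => /eqP.
  by rewrite eq_sym oner_eq0.
have [s sS] : exists s, s \in msupp (ta << r >>).
  have [S0|[s sS]] := fset_0Vmem (msupp (ta << r >>)); last by exists s.
  by case/eqP: nz; rewrite [ta _]monalgE S0 big_seq_fset0.
have uniqS t : t \in msupp (ta << r >>) -> t = s.
  move=> tS; apply/matrixP => i j; rewrite ord1.
  have [a Ha] := eig i; apply: (intr_inj_pchar0 charK).
  by rewrite (Ha _ tS) (Ha _ sS).
exists (ta << r >>)@_s, s; split; first by rewrite mcoeff_neq0.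
  by apply: contraTneq sS => ->; rewrite -mcoeff_neq0 t0 eqxx.
apply/malgP => t; rewrite mcoeffU; have [<-//|st] := eqVneq s t.
rewrite mulr0n mcoeff_outdom //; apply: contra_neqN st => tS.
by rewrite (uniqS t tS).
Qed.

End MonomialImages.

(** * Lattice morphisms and characters *)

Section LatticeMorphisms.
Variable m : nat.
Local Notation N := (m + m)%N.
Local Notation ZN := (ZN m).
Local Notation J := (Jmx m).
Implicit Types r s t : ZN.

(* The general case follows by adding a third vector [t] that is nonorthogonal to
   [r], [s] and [r + s]. *)
Lemma omega_partial_morphism (G : Type) (e : G) (op : G -> G -> G) (F : ZN -> G) :
  associative op -> left_id e op -> right_id e op ->
  (forall r x y, op x (F r) = op y (F r) -> x = y) -> F 0 = e ->
  (forall r s, omega r s != 0 -> F (r + s) = op (F r) (F s)) ->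
  forall r s, F (r + s) = op (F r) (F s).
Proof.
move=> opA e_op op_e canc F0 FD r s.
have [->|r0] := eqVneq r 0; first by rewrite add0r F0 e_op.
have [->|s0] := eqVneq s 0; first by rewrite addr0 F0 op_e.
(* When [s = - r] the auxiliary vector only has to avoid [r]; it recombines as [r + (- r + t)]. *)
have [rs0|rs0] := eqVneq (r + s) 0.
  have [i rt] := omega_nondeg r0; set t := zdelta i in rt.
  have E : s = - r by apply/eqP; rewrite -addr_eq0 addrC rs0.
  apply: (canc t); rewrite rs0 F0 e_op -opA E.
  rewrite -FD; last by rewrite omegaNl oppr_eq0.
  rewrite -FD ?addrA ?subrr ?add0r //.
  by rewrite omegaDr omegaNr omegaxx oppr0 add0r.
have [t [rt st rst]] := omega_avoid3 r0 s0 rs0.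
have [rs|/negPn/eqP rs] := boolP (omega r s != 0); first exact: FD.
apply: (canc t); rewrite -FD // -opA -(FD _ _ st) -FD ?addrA //.
by rewrite omegaDr rs add0r.
Qed.

Lemma morphD_scalez (n p : nat) (F : 'cV[int]_n -> 'cV[int]_p) (k : int) x :
  {morph F : x y / x + y} -> F (k *: x) = k *: F x.
Proof.
move=> FD; have Fn (n0 : nat) : F (n0%:Z *: x) = n0%:Z *: F x.
  elim: n0 => [|n0 IH]; first by rewrite !scale0r (morphD0 FD).
  by rewrite intS !scalerDl !scale1r FD IH.
by case: k => n0 //; rewrite NegzE !scaleNr (morphDN FD) Fn.
Qed.

Lemma zn_decomp r : r = \sum_i r i 0 *: zdelta i.
Proof.
apply/matrixP => i j; rewrite ord1 summxE (bigD1 i) //= big1 => [|k /negPf nk].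
  by rewrite !mxE !eqxx mulr1 addr0.
by rewrite !mxE (eq_sym i) nk mulr0.
Qed.

Lemma morphD_matrix (F : ZN -> ZN) : {morph F : x y / x + y} ->
  exists Q : 'M[int]_N, forall r, F r = Q *m r.
Proof.
move=> FD; exists (\matrix_(i, j) F (zdelta j) i 0) => r.
rewrite [in LHS](zn_decomp r) morphD_sum //; apply/matrixP => i j; rewrite ord1 summxE mxE.
by apply: eq_bigr => k _; rewrite morphD_scalez // !mxE mulrC.
Qed.

Lemma mulmx_ext_cV (A B : 'M[int]_N) : (forall r : ZN, A *m r = B *m r) -> A = B.
Proof.
move=> AB; apply/matrixP => i j.
have := congr1 (fun v : ZN => v i 0) (AB (zdelta j)).
by rewrite -!colE !mxE.
Qed.

(** For fixed [x] both forms are linear functionals, one vanishing on the kernel of the other, so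
    they are proportional; an auxiliary [t] shows that the factor does not depend on [x]. *)
Lemma omega_proportional (Q : 'M[int]_N) : (0 < m)%N ->
  (forall r s, omega r s = 0 -> omega (Q *m r) (Q *m s) = 0) ->
  exists k, forall r s, omega (Q *m r) (Q *m s) = k * omega r s.
Proof.
move=> m0 orth; pose om' r s := omega (Q *m r) (Q *m s).
(* The vector [omega x z *: y - omega x y *: z] is orthogonal to [x]. *)
have cross x y z : omega x z * om' x y = omega x y * om' x z.
  apply/eqP; rewrite -subr_eq0; apply/eqP.
  have := orth x (omega x z *: y - omega x y *: z).
  rewrite mulmxDr mulmxN -!scalemxAr !omegaDr !omegaNr !omegaZr; apply.
  by rewrite mulrC subrr.
have om'C x y : om' x y = - om' y x by rewrite /om' omegaC.
have i : 'I_N by case: m m0 => // k _; exact: ord0.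
(* [r0] is dual to [s0], with [omega r0 s0 = 1]; the factor is thus read off as an integer, without
   division. *)
pose s0 : ZN := zdelta i; pose r0 : ZN := - (J *m s0).
have rs1 : omega r0 s0 = 1.
  by rewrite omega_delta /r0 mulmxN mulmxA JJ mulNmx opprK mul1mx mxE !eqxx.
have r0nz : r0 != 0 by apply/eqP => E; move: rs1; rewrite E omega0l.
exists (om' r0 s0) => x y; rewrite -/(om' x y).
have [->|x0] := eqVneq x 0; first by rewrite /om' mulmx0 !omega0l mulr0.
have [t [xt rt _]] := omega_avoid3 x0 r0nz x0.
have e1 := cross x y t; have e2 := cross t x r0; have e3 := cross r0 t s0.
rewrite rs1 mul1r in e3.
have e4 : om' x t = om' r0 s0 * omega x t.
  apply: (mulfI rt); rewrite (om'C x t) mulrN -mulNr -(omegaC r0 t) e2.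
  by rewrite (om'C t r0) e3 (omegaC x t); ring.
by apply: (mulfI xt); rewrite e1 e4; ring.
Qed.

Lemma omega_mulmx (Q : 'M[int]_N) r s :
  omega (Q *m r) (Q *m s) = ((Q^T *m J *m Q *m r)^T *m s) 0 0.
Proof. by rewrite /omega !trmx_mul !trmxK !mulmxA. Qed.

Lemma omega_conformal (Q : 'M[int]_N) k :
  (forall r s, omega (Q *m r) (Q *m s) = k * omega r s) -> Q^T *m J *m Q = k *: J.
Proof.
move=> H; apply: mulmx_ext_cV => r; apply/matrixP => i j; rewrite ord1.
have dE (v : ZN) : (v^T *m zdelta i) 0 0 = v i 0 by rewrite -colE !mxE.
rewrite -dE -omega_mulmx H /omega -[RHS]dE -scalemxAl linearZ /= -scalemxAl.
by rewrite [RHS]mxE.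
Qed.

Lemma int_mul_eq1 (a b : int) : a * b = 1 -> a = 1 \/ a = -1.
Proof.
move=> /(congr1 absz); rewrite abszM => /eqP; rewrite muln_eq1 => /andP[/eqP a1 _].
by case: a a1 => [[|[]]|[]] //; [left|right].
Qed.

Variable K : fieldType.

(** The monomial $t^s$ evaluated at the torus point [l]. *)
Definition tchar (l : KN K m) s : K := \prod_i l i 0 ^ (s i 0).

Lemma tchar_neq0 l s : inTorus l -> tchar l s != 0.
Proof. by move=> lT; apply/prodf_neq0 => i _; rewrite expfz_neq0. Qed.

Lemma tcharD l : inTorus l -> {morph tchar l : r s / r + s >-> r * s}.
Proof.
move=> lT r s; rewrite /tchar -big_split; apply: eq_bigr => i _ /=.
by rewrite mxE expfzDr.
Qed.

Lemma tchar_delta l i : tchar l (zdelta i) = l i 0.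
Proof.
rewrite /tchar (bigD1 i) //= big1 => [|j /negPf nj]; first by rewrite !mxE !eqxx mulr1.
by rewrite mxE nj.
Qed.

Lemma charZ (chi : ZN -> K) k r : (forall r, chi r != 0) ->
  {morph chi : r s / r + s >-> r * s} -> chi (k *: r) = chi r ^ k.
Proof.
move=> nz chiD; have chi0 : chi 0 = 1.
  by apply: (mulfI (nz 0)); rewrite -chiD addr0 mulr1.
have Fn (n : nat) : chi (n%:Z *: r) = chi r ^+ n.
  elim: n => [|n IH]; first by rewrite !scale0r chi0.
  by rewrite intS !scalerDl !scale1r chiD IH exprS.
case: k => n //; rewrite NegzE scaleNr -exprnN -Fn.
by apply: (mulfI (nz (n.+1%:Z *: r))); rewrite -chiD subrr chi0 divff.
Qed.

Lemma char_tchar (chi : ZN -> K) : (forall r, chi r != 0) ->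
  {morph chi : r s / r + s >-> r * s} -> chi =1 tchar (\col_i chi (zdelta i)).
Proof.
move=> nz chiD r; have chi0 : chi 0 = 1.
  by apply: (mulfI (nz 0)); rewrite -chiD addr0 mulr1.
rewrite [in LHS](zn_decomp r) (big_morph chi chiD chi0).
by apply: eq_bigr => i _; rewrite charZ // mxE.
Qed.

End LatticeMorphisms.

(** * Classification of automorphisms in monomial form *)

Lemma malgU_inj (I : choiceType) (V : zmodType) (a b : V) (r s : I) :
  a != 0 -> << a *g r >> = << b *g s >> :> {malg V[I]} -> a = b /\ r = s.
Proof.
move=> a0 /(congr1 (mcoeff r)); rewrite mcoeffUU mcoeffU.
by case: eqVneq => [->|_]; rewrite ?mulr1n // mulr0n => /eqP; rewrite (negPf a0).
Qed.

Lemma scale_malgU (I : choiceType) (R : nzRingType) (a b : R) (r : I) :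
  a *: << b *g r >> = << a * b *g r >> :> {malg R[I]}.
Proof. by rewrite [LHS](congr1 _ (malgUZ b r)) scalerA -malgUZ. Qed.

Lemma lin_gpbUU (K : fieldType) (I : zmodType) (w : I -> I -> K)
    (sg : {malg K[I]} -> {malg K[I]}) (a b : K) (r s r' s' : I) :
  lin sg -> (forall f g, sg (gpb w f g) = gpb w (sg f) (sg g)) ->
  sg << r >> = << a *g r' >> -> sg << s >> = << b *g s' >> ->
  w r s *: sg << r + s >> = << w r' s' * a * b *g (r' + s') >>.
Proof.
move=> [_ sZ] sP Er Es; have := sP << r >> << s >>.
by rewrite Er Es !gpbUU !mulr1 malgUZ sZ.
Qed.

Section Classification.
Variables (K : fieldType) (m : nat).
Hypothesis charK : [pchar K] =i pred0.
Hypothesis m0 : (0 < m)%N.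
Local Notation N := (m + m)%N.
Local Notation ZN := (ZN m).
Local Notation J := (Jmx m).
Local Notation L := {malg K[ZN]}.
Local Notation wK := (@wK K m).
Implicit Types (r s t b : ZN) (f g : L).

Lemma lie_inverse_functions (sg ta : L -> L) :
  lie_inverse wK sg ta -> lie_inverse wK ta sg ->
  exists c q, [/\ c 0 = 1, q 0 = 0,
    (forall r, c r != 0), (forall r, r != 0 -> q r != 0) &
    forall r, r != 0 -> sg << r >> = << c r *g q r >>].
Proof.
move=> sgta tasg.
(* The unique point of the support is extracted by [head], so no choice of witnesses is made. At
   [0], the value [q 0 = 0] is what additivity requires and [c 0 = 1] is a nonzero placeholder. *)
pose q r := if r == 0 then 0 else head 0 (msupp (sg << r >>)).
pose c r : K := if r == 0 then 1 else (sg << r >>)@_(q r).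
have mono r : r != 0 -> [/\ c r != 0, q r != 0 & sg << r >> = << c r *g q r >>].
  move=> r0; have [a [s [a0 s0 E]]] := lie_inverse_monomial charK tasg sgta r0.
  have qE : q r = s.
    rewrite /q (negPf r0) E msuppU (negPf a0).
    have -> : ([fset s]%fset : seq ZN) = [:: s] => //.
    apply: perm_small_eq => //; apply: uniq_perm => [||t]; rewrite ?fset_uniq //.
    by rewrite mem_seq1 in_fset1.
  by rewrite /c qE (negPf r0) E mcoeffUU.
exists c, q; split.
- by rewrite /c eqxx.
- by rewrite /q eqxx.
- move=> r; have [->|/mono[]//] := eqVneq r 0.
  by rewrite /c eqxx oner_neq0.
- by move=> r /mono[].
- by move=> r /mono[].
Qed.

(** Apply [sg] to the bracket of [<<r>>] and [<<s>>]: if [omega r s] is nonzero, degrees and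
    coefficients on the two sides agree; if it is zero, the right-hand coefficient must vanish. Full
    additivity comes from [omega_partial_morphism]. *)
Lemma lie_inverse_bracket (sg ta : L -> L) (c : ZN -> K) (q : ZN -> ZN) :
  lie_inverse wK sg ta -> (forall r, c r != 0) -> q 0 = 0 ->
  (forall r, r != 0 -> sg << r >> = << c r *g q r >>) ->
  [/\ forall r s, q (r + s) = q r + q s,
      forall r s, omega r s = 0 -> omega (q r) (q s) = 0 &
      forall r s, omega r s != 0 ->
        wK r s * c (r + s) = wK (q r) (q s) * c r * c s].
Proof.
move=> [[sD sZ] sP s0 sK] cnz q0 E.
have br r s : r != 0 -> s != 0 ->
    wK r s *: sg << r + s >> = << wK (q r) (q s) * c r * c s *g (q r + q s) >>.
  by move=> rn sn; apply: lin_gpbUU => //; apply: E.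
have brnz r s : omega r s != 0 ->
    wK r s * c (r + s) = wK (q r) (q s) * c r * c s /\ q (r + s) = q r + q s.
  move=> rs; have rn : r != 0 by apply: contraNneq rs => ->; rewrite omega0l.
  have sn : s != 0 by apply: contraNneq rs => ->; rewrite omega0r.
  have rsn : r + s != 0.
    by apply: contraNneq rs => e; rewrite -[s](addKr r) e addr0 omegaNr omegaxx oppr0.
  have := br r s rn sn; rewrite E // scale_malgU => /malgU_inj; apply.
  by rewrite mulf_neq0 // wK_eq0.
split=> [|r s rs|r s /brnz[]//].
  apply: (omega_partial_morphism (e := 0)) => //; first exact: addrA.
  - exact: add0r.
  - exact: addr0.
  - by move=> r x y /addIr.
  by move=> r s /brnz[].
have [->|rn] := eqVneq r 0; first by rewrite q0 omega0l.
have [->|sn] := eqVneq s 0; first by rewrite q0 omega0r.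
have := br r s rn sn; rewrite /wK rs scale0r => /(congr1 (mcoeff (q r + q s))).
rewrite mcoeff0 mcoeffUU => /esym/eqP; rewrite !mulf_eq0 !(negPf (cnz _)) !orbF.
by rewrite (intr_eq0_pchar0 charK) => /eqP.
Qed.

Lemma lie_inverse_classification (sg ta : L -> L) :
  lie_inverse wK sg ta -> lie_inverse wK ta sg ->
  exists (Q : 'M[int]_N) (l : KN K m) (k : int),
    [/\ Q \in unitmx, k = 1 \/ k = -1, Q^T *m J *m Q = k *: J, inTorus l &
        forall r, r != 0 -> sg << r >> = << k%:~R * tchar l (Q *m r) *g (Q *m r) >>].
Proof.
move=> sgta tasg.
have [c [q [c0 q0 cnz qnz sE]]] := lie_inverse_functions sgta tasg.
have [d [p [d0 p0 dnz pnz tE]]] := lie_inverse_functions tasg sgta.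
have [qD qO qc] := lie_inverse_bracket sgta cnz q0 sE.
have [pD pO _] := lie_inverse_bracket tasg dnz p0 tE.
(* Compare degrees in [s1 (s2 <<r>>) = <<r>>]. *)
have comp (s1 s2 : L -> L) (c1 c2 : ZN -> K) q1 q2 : lie_inverse wK s1 s2 ->
    (forall r, r != 0 -> s1 << r >> = << c1 r *g q1 r >>) ->
    (forall r, r != 0 -> s2 << r >> = << c2 r *g q2 r >>) ->
    (forall r, r != 0 -> q2 r != 0) -> q1 0 = 0 -> q2 0 = 0 -> forall r, q1 (q2 r) = r.
  move=> [[_ s1Z] _ _ s1K] E1 E2 q2nz q10 q20 r.
  have [->|rn] := eqVneq r 0; first by rewrite q20.
  have := s1K << r >>; rewrite noconstU // E2 // malgUZ s1Z E1 ?q2nz // scale_malgU.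
  by move/esym/malgU_inj; rewrite oner_eq0 => -[].
have qp := comp _ _ _ _ _ _ sgta sE tE pnz q0 p0.
have pq := comp _ _ _ _ _ _ tasg tE sE qnz p0 q0.
have [Q QE] := morphD_matrix qD; have [P PE] := morphD_matrix pD.
have PQ : P *m Q = 1%:M.
  by apply: mulmx_ext_cV => r; rewrite -mulmxA -QE -PE pq mul1mx.
have Qu : Q \in unitmx by case: (mulmx1_unit PQ).
have [k kE] : exists k, forall r s, omega (Q *m r) (Q *m s) = k * omega r s.
  by apply: omega_proportional => // r s; rewrite -!QE; apply: qO.
have [k' k'E] : exists k, forall r s, omega (P *m r) (P *m s) = k * omega r s.
  by apply: omega_proportional => // r s; rewrite -!PE; apply: pO.
(* [P] inverts [Q], so their multipliers are inverse integers. *)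
have kk' : k' * k = 1.
  have [i _] : exists i : 'I_N, True by case: m m0 => // n _; exists ord0.
  have [|j] := @omega_nondeg m (zdelta i).
    by apply/eqP => /(congr1 (fun v : ZN => v i 0)) /eqP; rewrite !mxE !eqxx.
  move=> nz; apply: (mulIf nz); rewrite mul1r -mulrA -kE -k'E !mulmxA PQ.
  by rewrite !mul1mx.
have k1 : k = 1 \/ k = -1 by apply: (@int_mul_eq1 _ k'); rewrite mulrC.
have kK2 : k%:~R * k%:~R = 1 :> K by case: k1 => ->; rewrite ?rmorphN ?mulrNN mulr1.
have knz : (k%:~R : K) != 0.
  by apply: contra_eq_neq kK2 => ->; rewrite mul0r eq_sym oner_neq0.
(* On nonorthogonal pairs the coefficient relation reads [c (r + s) = k * c r * c s]; as
   [k * k = 1], the factor [k] makes it multiplicative. *)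
pose chi r : K := if r == 0 then 1 else k%:~R * c r.
have chinz r : chi r != 0 by rewrite /chi; case: ifP => _; [exact: oner_neq0 | exact: mulf_neq0].
have chiD : {morph chi : r s / r + s >-> r * s}.
  apply: (omega_partial_morphism (e := 1)) => //; first exact: mulrA.
  - exact: mul1r.
  - exact: mulr1.
  - by move=> r x y /(mulIf (chinz r)).
  - by rewrite /chi eqxx.
  move=> r s rs; have rn : r != 0 by apply: contraNneq rs => ->; rewrite omega0l.
  have sn : s != 0 by apply: contraNneq rs => ->; rewrite omega0r.
  have rsn : r + s != 0.
    by apply: contraNneq rs => e; rewrite -[s](addKr r) e addr0 omegaNr omegaxx oppr0.
  have wn : wK r s != 0 by rewrite wK_eq0.
  rewrite /chi (negPf rn) (negPf sn) (negPf rsn); apply: (mulfI wn).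
  by rewrite mulrCA qc // !QE /wK kE rmorphM /=; ring.
(* The torus element is to be evaluated at the target degree [Q r], so the character is transported
   by [invmx Q]. *)
pose psi s := chi (invmx Q *m s).
have psiD : {morph psi : r s / r + s >-> r * s} by move=> r s; rewrite /psi mulmxDr chiD.
exists Q, (\col_i psi (zdelta i)), k; split=> //.
- exact: omega_conformal.
- by move=> i; rewrite mxE chinz.
move=> r rn; have <- : chi r = tchar (\col_i psi (zdelta i)) (Q *m r).
  by rewrite -(char_tchar _ psiD) => [|s]; [rewrite /psi mulKmx | exact: chinz].
by rewrite (sE r rn) QE /chi (negPf rn) mulrA kK2 mul1r.
Qed.

End Classification.

(** * Automorphisms of the Witt algebra *)

(** [gmap] acts on coefficients in place; here degrees move as well. *)
HB.lock Definition gpush (I I' : choiceType) (V V' : zmodType) (q : I -> I')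
  (A : I -> V -> V') (f : {malg V[I]}) : {malg V'[I']} :=
  \sum_(r <- msupp f) << A r f@_r *g q r >>.

Section Push.
Variables (I I' : choiceType) (V V' : zmodType) (q : I -> I') (A : I -> V -> V').
Hypothesis AD : forall r, {morph A r : x y / x + y}.

Lemma gpushEw (d : {fset I}) f : (msupp f `<=` d)%fset ->
  gpush q A f = \sum_(r <- d) << A r f@_r *g q r >>.
Proof.
move=> le; rewrite gpush.unlock; apply/big_fset_incl => // r _ /mcoeff_outdom ->.
by rewrite (morphD0 (AD r)) monalgU0.
Qed.

Lemma gpushD : {morph gpush q A : f g / f + g}.
Proof.
move=> f g; pose d := (msupp f `|` msupp g)%fset.
rewrite !(@gpushEw d) ?fsubsetUl ?fsubsetUr ?msuppD_le //.
by rewrite -big_split; apply: eq_bigr => r _ /=; rewrite mcoeffD AD monalgUD.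
Qed.

Lemma gpushU u r : gpush q A << u *g r >> = << A r u *g q r >>.
Proof. by rewrite (gpushEw msuppU_le) big_seq_fset1 mcoeffUU. Qed.

Lemma gpush_coef f r : injective q -> (gpush q A f)@_(q r) = A r f@_r.
Proof.
move=> qI; move: f; apply: malg_additive_ext => [x y|x y|s u].
- by rewrite gpushD mcoeffD.
- by rewrite mcoeffD AD.
by rewrite gpushU !mcoeffU (inj_eq qI); case: eqVneq => [->|] //; rewrite !mulr0n (morphD0 (AD r)).
Qed.
End Push.

Lemma invmx_mul (R : comUnitRingType) n (A B : 'M[R]_n) :
  A \in unitmx -> B \in unitmx -> invmx (A *m B) = invmx B *m invmx A.
Proof.
move=> uA uB; have uAB : A *m B \in unitmx by rewrite unitmx_mul uA.
by rewrite -[RHS](mulKmx uAB) -(mulmxA A) (mulmxA B) mulmxV // mul1mx mulmxV // mulmx1.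
Qed.

(** * Torus characters and the action of the conformal symplectic group *)

Section TorusCharacters.
Variables (K : fieldType) (m : nat).
Local Notation N := (m + m)%N.
Local Notation ZN := (ZN m).
Local Notation J := (Jmx m).
Implicit Types (r s : ZN) (Q : 'M[int]_N) (l : KN K m).

Lemma tchar_tmul l1 l2 s : tchar (tmul l1 l2) s = tchar l1 s * tchar l2 s.
Proof. by rewrite /tchar -big_split; apply: eq_bigr => i _; rewrite mxE expfzMl. Qed.

(* [(tact Q l)^s = l^(Q^-1 s)], see [tchar_tact]. *)
Definition tact Q l : KN K m := \col_i tchar l (invmx Q *m zdelta i).

Lemma tact_torus Q l : inTorus l -> inTorus (tact Q l).
Proof. by move=> lT i; rewrite mxE tchar_neq0. Qed.

Lemma tchar_tact Q l s : inTorus l -> tchar (tact Q l) s = tchar l (invmx Q *m s).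
Proof.
move=> lT; rewrite /tact -(char_tchar (chi := fun s => tchar l (invmx Q *m s))) //.
  by move=> r; apply: tchar_neq0.
by move=> r t; rewrite mulmxDr tcharD.
Qed.

Lemma tmul_torus l1 l2 : inTorus l1 -> inTorus l2 -> inTorus (tmul l1 l2).
Proof. by move=> l1T l2T i; rewrite mxE mulf_neq0. Qed.

Lemma inGSpM Q1 Q2 : inGSp Q1 -> inGSp Q2 -> inGSp (Q1 *m Q2).
Proof.
move=> [u1 h1] [u2 h2]; split; first by rewrite unitmx_mul u1.
have -> : (Q1 *m Q2)^T *m J *m (Q1 *m Q2) = Q2^T *m (Q1^T *m J *m Q1) *m Q2.
  by rewrite trmx_mul !mulmxA.
by case: h1 => ->; case: h2 => h2; rewrite ?mulmxN ?mulNmx h2 ?opprK; auto.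
Qed.

Lemma inGSpV Q : inGSp Q -> inGSp (invmx Q).
Proof.
move=> [u h]; split; first by rewrite unitmx_inv.
have E : (invmx Q)^T *m (Q^T *m J *m Q) *m invmx Q = J.
  by rewrite !mulmxA -trmx_mul mulmxV // trmx1 mul1mx mulmxK.
by case: h E => ->; rewrite ?mulmxN ?mulNmx => E; [left | right; rewrite -[in RHS]E opprK].
Qed.

Lemma tact_gsp_action : gsp_action tact.
Proof.
split; first by move=> Q l _; apply: tact_torus.
split.
  by move=> Q l1 l2 _ _ _; apply/matrixP => i j; rewrite !mxE tchar_tmul.
split=> [l lT|Q1 Q2 l [u1 _] [u2 _] lT].
  by apply/matrixP => i j; rewrite ord1 mxE invmx1 mul1mx tchar_delta.
apply/matrixP => i j; rewrite ord1 [LHS]mxE [RHS]mxE tchar_tact // mulmxA.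
by rewrite -invmx_mul.
Qed.

End TorusCharacters.

Section DotInvariance.
Variables (K : fieldType) (m : nat).
Local Notation N := (m + m)%N.
Local Notation ZN := (ZN m).
Local Notation J := (Jmx m).
Local Notation KN := (KN K m).
Local Notation intmx := (map_mx (fun z : int => z%:~R : K)).
Implicit Types (r s : ZN) (Q : 'M[int]_N) (l u v : KN).

(** The contragredient $Q^{-\top}$ over [K]: it keeps [dotZ u s] fixed when [s] moves by [Q]. *)
Definition dualmx Q : 'M[K]_N := intmx (invmx Q)^T.

Lemma map_intmxM p n k (A : 'M[int]_(p, n)) (B : 'M[int]_(n, k)) :
  intmx (A *m B) = intmx A *m intmx B.
Proof.
apply/matrixP => i j; rewrite !mxE rmorph_sum; apply: eq_bigr => h _.
by rewrite !mxE rmorphM.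
Qed.

Lemma map_intmx1 n : intmx (1%:M : 'M[int]_n) = 1%:M.
Proof. by apply/matrixP => i j; rewrite !mxE; case: eqP. Qed.

Lemma dotZ_dualmx Q u s : Q \in unitmx -> dotZ (dualmx Q *m u) (Q *m s) = dotZ u s.
Proof.
move=> Qu; rewrite !dotZ_mx map_intmxM trmx_mul /dualmx map_trmx trmxK -!mulmxA.
by rewrite (mulmxA (intmx (invmx Q))) -map_intmxM mulVmx // map_intmx1 mul1mx.
Qed.

Lemma dualmxM Q1 Q2 : Q1 \in unitmx -> Q2 \in unitmx ->
  dualmx (Q1 *m Q2) = dualmx Q1 *m dualmx Q2.
Proof.
move=> u1 u2; by rewrite /dualmx -map_intmxM -trmx_mul -invmx_mul.
Qed.

Lemma dualmx1 : dualmx 1%:M = 1%:M.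
Proof. by rewrite /dualmx invmx1 trmx1 map_intmx1. Qed.

(** Since $k^2=1$, the conformal identity rearranges to $Q^{-\top}J=kJQ$. This is why $h_r$ is sent
    to a multiple of $h_{Qr}$. *)
Lemma dualmx_rbar Q (k : int) r : Q \in unitmx -> k * k = 1 -> Q^T *m J *m Q = k *: J ->
  dualmx Q *m rbarK K r = k%:~R *: rbarK K (Q *m r).
Proof.
move=> Qu kk E; rewrite /dualmx /rbarK -map_intmxM.
have -> : (invmx Q)^T *m (J *m r) = k *: (J *m (Q *m r)).
  rewrite -[J in LHS]scale1r -kk -scalerA -E.
  rewrite -scalemxAl -scalemxAr -!mulmxA; congr (_ *: _).
  by rewrite (mulmxA (invmx Q)^T) -trmx_mul mulmxV // trmx1 mul1mx.
by apply/matrixP => i j; rewrite !mxE rmorphM.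
Qed.

End DotInvariance.

Section WittAutomorphisms.
Variables (K : fieldType) (m : nat).
Hypothesis charK : [pchar K] =i pred0.
Local Notation N := (m + m)%N.
Local Notation ZN := (ZN m).
Local Notation J := (Jmx m).
Local Notation KN := (KN K m).
Local Notation W := (W K m).
Local Notation L := {malg K[ZN]}.
Local Notation wK := (@wK K m).
Local Notation dualmx := (@dualmx K m).
Implicit Types (r s : ZN) (Q : 'M[int]_N) (l u v : KN) (f g : W) (x y : L).

Definition wbeta r s u v : KN := dotZ u s *: v - dotZ v r *: u.

Lemma bracketW_gbr : @bracketW K m =2 gbr wbeta.
Proof. by move=> f g; rewrite gbr.unlock. Qed.

Lemma wbetaDl r s v : {morph (wbeta r s)^~ v : u u' / u + u'}.
Proof. by move=> u u'; rewrite /wbeta dotZDl scalerDl scalerDr opprD addrACA. Qed.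

Lemma wbetaDr r s u : {morph wbeta r s u : v v' / v + v'}.
Proof. by move=> v v'; rewrite /wbeta dotZDl scalerDl scalerDr opprD addrACA. Qed.

Lemma bracketWDl g : {morph (@bracketW K m)^~ g : f f' / f + f'}.
Proof. by move=> f f'; rewrite !bracketW_gbr; apply: gbrDl; [exact: wbetaDl|exact: wbetaDr]. Qed.

Lemma bracketWDr f : {morph @bracketW K m f : g g' / g + g'}.
Proof. by move=> g g'; rewrite !bracketW_gbr; apply: gbrDr; [exact: wbetaDl|exact: wbetaDr]. Qed.

Lemma bracketWUU u r v s :
  bracketW << u *g r >> << v *g s >> = << wbeta r s u v *g (r + s) >>.
Proof. by rewrite bracketW_gbr; apply: gbrUU; [exact: wbetaDl|exact: wbetaDr]. Qed.

Lemma bracketW_ext (U : zmodType) (F G : W -> W -> U) :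
  (forall g, {morph F^~ g : x y / x + y}) -> (forall f, {morph F f : x y / x + y}) ->
  (forall g, {morph G^~ g : x y / x + y}) -> (forall f, {morph G f : x y / x + y}) ->
  (forall r u s v, F << u *g r >> << v *g s >> = G << u *g r >> << v *g s >>) ->
  F =2 G.
Proof. exact: gbr_ext. Qed.

Lemma scaleWE a f r : (scaleW a f)@_r = a *: f@_r.
Proof. by rewrite mcoeffE; case: msuppP => //; rewrite scaler0. Qed.

Lemma scaleWD a : {morph @scaleW K m a : f g / f + g}.
Proof.
move=> f g; apply/malgP => k.
by rewrite [RHS]mcoeffD !scaleWE mcoeffD scalerDr.
Qed.

Lemma scaleWU a u r : scaleW a << u *g r >> = << a *: u *g r >>.
Proof.
have -> : scaleW a << u *g r >> = gmap (fun=> *:%R a) << u *g r >> by rewrite gmap.unlock.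
by apply: gmapU => _; rewrite scaler0.
Qed.

Lemma scaleW1 f : scaleW 1 f = f.
Proof. by apply/malgP => k; rewrite scaleWE scale1r. Qed.

(** Conjugation of derivations by the automorphism $t^r\mapsto l^{Qr}t^{Qr}$ of $A_N$. *)
Definition Phi Q l : W -> W :=
  gpush (fun r => Q *m r) (fun r u => tchar l (Q *m r) *: (dualmx Q *m u)).

Lemma PhiA Q l r : {morph (fun u => tchar l (Q *m r) *: (dualmx Q *m u)) : u v / u + v}.
Proof. by move=> u v; rewrite mulmxDr scalerDr. Qed.

Lemma PhiD Q l : {morph Phi Q l : f g / f + g}.
Proof. by move=> f g; apply: gpushD => r; apply: PhiA. Qed.

Lemma PhiU Q l u r :
  Phi Q l << u *g r >> = << tchar l (Q *m r) *: (dualmx Q *m u) *g (Q *m r) >>.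
Proof. exact: (gpushU _ (PhiA Q l)). Qed.

Lemma Phi_coef Q l f r : Q \in unitmx ->
  (Phi Q l f)@_(Q *m r) = tchar l (Q *m r) *: (dualmx Q *m f@_r).
Proof.
by move=> Qu; apply: (gpush_coef (PhiA Q l)); apply: (can_inj (mulKmx Qu)).
Qed.

Lemma Phi_scale Q l a f : Phi Q l (scaleW a f) = scaleW a (Phi Q l f).
Proof.
move: f; apply: malg_additive_ext => [f g|f g|r u].
- by rewrite (scaleWD a f) PhiD.
- by rewrite (PhiD Q l f) scaleWD.
rewrite [LHS](congr1 (Phi Q l) (scaleWU a u r)) [LHS]PhiU.
rewrite [RHS](congr1 (scaleW a) (PhiU Q l u r)) [RHS]scaleWU; congr (<< _ *g _ >>).
by rewrite -scalemxAr !scalerA mulrC.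
Qed.

Lemma Phi_bracket Q l f g : Q \in unitmx -> inTorus l ->
  Phi Q l (bracketW f g) = bracketW (Phi Q l f) (Phi Q l g).
Proof.
move=> Qu lT; move: f g; apply: bracketW_ext.
- by move=> g x y /=; rewrite (bracketWDl g x) PhiD.
- by move=> f x y /=; rewrite (bracketWDr f x) PhiD.
- by move=> g x y /=; rewrite (PhiD Q l x) (bracketWDl _ (Phi Q l x)).
- by move=> f x y /=; rewrite (PhiD Q l x) (bracketWDr _ (Phi Q l x)).
move=> r u s v; rewrite bracketWUU !PhiU bracketWUU mulmxDr; congr (<< _ *g _ >>).
rewrite tcharD // /wbeta !dotZZl !dotZ_dualmx // mulmxBr -!scalemxAr scalerBr !scalerA.
by congr (_ *: _ - _ *: _); ring.
Qed.

(** This law explains the form of [tact]: in degree [Q1 Q2 r] the inner factor is the character [l2]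
    at [Q2 r]. *)
Lemma Phi_comp Q1 l1 Q2 l2 f : Q1 \in unitmx -> Q2 \in unitmx -> inTorus l2 ->
  Phi Q1 l1 (Phi Q2 l2 f) = Phi (Q1 *m Q2) (tmul l1 (tact Q1 l2)) f.
Proof.
move=> u1 u2 l2T; move: f; apply: malg_additive_ext => [f g|f g|r u].
- by rewrite (PhiD Q2 l2 f) PhiD.
- by rewrite PhiD.
rewrite [LHS](congr1 (Phi Q1 l1) (PhiU Q2 l2 u r)) [LHS]PhiU [RHS]PhiU.
congr (<< _ *g _ >>); first exact: mulmxA.
rewrite -scalemxAr scalerA dualmxM // -!mulmxA; congr (_ *: _).
by rewrite tchar_tmul tchar_tact // mulKmx.
Qed.

Lemma Phi1 f : Phi 1%:M (const_mx 1) f = f.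
Proof.
move: f; apply: malg_additive_ext => [f g|//|r u]; first by rewrite PhiD.
rewrite PhiU dualmx1 !mul1mx /tchar big1 ?scale1r // => i _.
by rewrite mxE exp1rz.
Qed.

Lemma inGSp_conformal Q : inGSp Q ->
  exists k : int, [/\ k * k = 1, Q^T *m J *m Q = k *: J & Q \in unitmx].
Proof.
move=> [Qu [] E]; [exists 1 | exists (-1)]; split=> //; first by rewrite E scale1r.
by rewrite E scaleN1r.
Qed.

Lemma Phi_inH Q l f : inGSp Q -> inH f -> inH (Phi Q l f).
Proof.
move=> /inGSp_conformal[k [kk E Qu]] fH s s0.
have [r rE] : exists r, s = Q *m r by exists (invmx Q *m s); rewrite mulKVmx.
have r0 : r != 0 by apply: contraNneq s0 => r0; rewrite rE r0 mulmx0.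
have [c fr] := fH r r0; exists (tchar l s * c * k%:~R).
by rewrite rE Phi_coef // fr -scalemxAr (dualmx_rbar _ _ Qu kk E) !scalerA.
Qed.

Lemma Phi_inH' Q l f : inGSp Q -> inH' f -> inH' (Phi Q l f).
Proof.
move=> QG [f0 fH]; split; last exact: Phi_inH.
by rewrite -(mulmx0 _ Q) Phi_coef ?f0 ?mulmx0 ?scaler0 //; case: QG.
Qed.

(** Sends [<<r>>] to $h_r$ and [<<0>>] to zero, identifying $\mathcal H_N'$ with the Poisson algebra
    modulo [<<0>>]. *)
Definition toW x : W := gmap (fun r a => a *: rbarK K r) x.

(* The value at [r = 0] is [0 / 0 = 0]. *)
Definition ofW f : L := gmap (fun r u => dotZ u (J *m r) / wK r (J *m r)) f.

Lemma toWE x r : (toW x)@_r = x@_r *: rbarK K r.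
Proof. by rewrite gmapE ?scale0r. Qed.

Lemma toWU a r : toW << a *g r >> = << a *: rbarK K r *g r >>.
Proof. by rewrite /toW gmapU // => s; rewrite scale0r. Qed.

Lemma toWD : {morph toW : x y / x + y}.
Proof. by apply: gmapD => r a b; rewrite scalerDl. Qed.

Lemma toWZ a x : toW (a *: x) = scaleW a (toW x).
Proof. by apply/malgP => k; rewrite scaleWE !toWE mcoeffZ scalerA. Qed.

Lemma dotZ0l r : dotZ (0 : KN) r = 0.
Proof. by rewrite (morphD0 (@dotZDl K m r)). Qed.

Lemma ofWE f r : (ofW f)@_r = dotZ f@_r (J *m r) / wK r (J *m r).
Proof. by rewrite gmapE // dotZ0l mul0r. Qed.

Lemma ofWD : {morph ofW : f g / f + g}.
Proof. by apply: gmapD => r a b; rewrite dotZDl mulrDl. Qed.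

Lemma ofWZ a f : ofW (scaleW a f) = a *: ofW f.
Proof. by apply/malgP => k; rewrite mcoeffZ !ofWE scaleWE dotZZl mulrA. Qed.

Lemma ofW0 f : (ofW f)@_0 = 0.
Proof. by rewrite ofWE wK0l invr0 mulr0. Qed.

(** [omega r (J r)] is the squared Euclidean norm of [J r], so the division in [ofW] is legitimate
    in every nonzero degree. *)
Lemma wK_J_neq0 r : r != 0 -> wK r (J *m r) != 0.
Proof.
move=> r0; rewrite wK_eq0 //.
have -> : omega r (J *m r) = zdot (J *m r) (J *m r).
  by rewrite /omega mxE; apply: eq_bigr => i _; rewrite mxE.
rewrite gt_eqF // zdot_gt0 //; apply: contraNneq r0 => E; apply/eqP/J_inj.
by rewrite E mulmx0.
Qed.

Lemma toWK x : ofW (toW x) = noconst x.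
Proof.
apply/malgP => k; rewrite ofWE toWE mcoeffB mcoeffU dotZZl dotZ_rbar.
have [<-|k0] := eqVneq 0 k; first by rewrite -/(wK 0 (J *m 0)) wK0l mulr0 mul0r subrr.
by rewrite mulr0n subr0 mulfK // wK_J_neq0 // eq_sym.
Qed.

Lemma ofWK f : inH' f -> toW (ofW f) = f.
Proof.
move=> [f0 fH]; apply/malgP => k; rewrite toWE.
have [->|k0] := eqVneq k 0; first by rewrite ofW0 f0 scale0r.
have [c E] := fH k k0; rewrite ofWE E dotZZl dotZ_rbar mulfK //.
exact: wK_J_neq0.
Qed.

Lemma toW_inH' x : inH' (toW x).
Proof.
split; first by rewrite toWE rbarK0 scaler0.
by move=> r r0; exists x@_r; rewrite toWE.
Qed.

(** By antisymmetry the two terms of [wbeta] share the factor [wK r s], leaving $\overline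
    r+\overline s=\overline{r+s}$. *)
Lemma toW_bracket x y : toW (gpb wK x y) = bracketW (toW x) (toW y).
Proof.
move: x y; apply: gbr_ext.
- by move=> g x y /=; rewrite (gpbDl _ g x) toWD.
- by move=> f x y /=; rewrite (gpbDr _ f x) toWD.
- by move=> g x y /=; rewrite (toWD x) (bracketWDl _ (toW x)).
- by move=> f x y /=; rewrite (toWD x) (bracketWDr _ (toW x)).
move=> r u s v; rewrite [LHS](congr1 toW (gpbUU _ u r v s)) [LHS]toWU.
rewrite [RHS](congr2 (@bracketW K m) (toWU u r) (toWU v s)) [RHS]bracketWUU.
congr (<< _ *g _ >>).
rewrite /wbeta !dotZZl !dotZ_rbar -/(wK r s) -/(wK s r) (wKC _ r s) rbarKD !scalerA.
by rewrite mulrN mulNr scaleNr opprK scalerDr addrC; congr (_ *: _ + _ *: _); ring.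
Qed.

Lemma gpb_coef0 x y : (gpb wK x y)@_0 = 0.
Proof.
move: x y; apply: (gbr_ext (G := fun _ _ => 0)).
- by move=> g x y /=; rewrite (gpbDl _ g x) mcoeffD.
- by move=> f x y /=; rewrite (gpbDr _ f x) mcoeffD.
- by move=> g x y /=; rewrite addr0.
- by move=> f x y /=; rewrite addr0.
move=> r u s v; rewrite gpbUU mcoeffU; case: eqP => // rs.
have -> : s = - r by apply/eqP; rewrite -addr_eq0 addrC rs.
by rewrite wKNr wKxx oppr0 !mul0r mul0rn.
Qed.

Lemma Phi_toW Q l (k : int) a r : Q \in unitmx -> k * k = 1 -> Q^T *m J *m Q = k *: J ->
  Phi Q l (toW << a *g r >>) = toW << k%:~R * tchar l (Q *m r) * a *g (Q *m r) >>.
Proof.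
move=> Qu kk E; rewrite [LHS](congr1 (Phi Q l) (toWU a r)) [LHS]PhiU [RHS]toWU.
congr (<< _ *g _ >>); rewrite -scalemxAr (dualmx_rbar _ _ Qu kk E) !scalerA.
by congr (_ *: _); ring.
Qed.

End WittAutomorphisms.

(** * The Hamiltonian algebra and its automorphisms *)

Section HamiltonianAlgebra.
Variables (K : fieldType) (m : nat).
Hypothesis charK : [pchar K] =i pred0.
Local Notation N := (m + m)%N.
Local Notation ZN := (ZN m).
Local Notation J := (Jmx m).
Local Notation KN := (KN K m).
Local Notation W := (W K m).
Local Notation L := {malg K[ZN]}.
Local Notation wK := (@wK K m).
Implicit Types (r s : ZN) (Q : 'M[int]_N) (l u v : KN) (f g : W) (x y : L).

Lemma bracketWC f g : bracketW f g = - bracketW g f.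
Proof.
move: f g; apply: bracketW_ext.
- by move=> g x y /=; rewrite (bracketWDl g x).
- by move=> f x y /=; rewrite (bracketWDr f x).
- by move=> g x y /=; rewrite (bracketWDr g x) opprD.
- by move=> f x y /=; rewrite (bracketWDl f x) opprD.
move=> r u s v; rewrite [LHS]bracketWUU [RHS](congr1 -%R (bracketWUU v s u r)).
rewrite -[RHS]monalgUN; congr (<< _ *g _ >>); first exact: addrC.
by rewrite /wbeta opprB.
Qed.

Lemma bracketW_degree u x :
  bracketW << u *g 0 >> (toW x) = toW (gwt (fun r => dotZ u r) x).
Proof.
move: x; apply: malg_additive_ext => [x y|x y|r a].
- by rewrite toWD (bracketWDr _ (toW x)).
- by have [wD _] := gwt_lin (fun r => dotZ u r); rewrite wD toWD.
rewrite [LHS](congr1 (bracketW _) (toWU a r)) [LHS]bracketWUU.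
rewrite [RHS](congr1 (@toW K m) (gwtU _ a r)) [RHS]toWU.
congr (<< _ *g _ >>); first exact: add0r.
rewrite /wbeta scalerA [dotZ _ 0](_ : _ = 0) ?scale0r ?subr0 //.
by rewrite (morphD0 (@dotZDr K m _)).
Qed.

Lemma bracketW_cartan u v : bracketW << u *g 0 >> << v *g 0 >> = 0 :> W.
Proof.
rewrite [LHS]bracketWUU /wbeta !(morphD0 (@dotZDr K m _)) !scale0r subrr.
exact: monalgU0.
Qed.

Lemma inH_decomp f : inH f -> f = << f@_0 *g 0 >> + toW (ofW f).
Proof.
move=> fH; apply/malgP => k; rewrite mcoeffD mcoeffU toWE.
have [<-|k0] := eqVneq 0 k; first by rewrite mulr1n ofW0 scale0r addr0.
rewrite eq_sym in k0; have [c E] := fH k k0.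
by rewrite mulr0n add0r ofWE E dotZZl dotZ_rbar mulfK // wK_J_neq0.
Qed.

(** The bracket of the two Cartan parts vanishes, and every other term is in the image of [toW]. *)
Lemma inH_bracket f g : inH f -> inH g -> inH' (bracketW f g).
Proof.
move=> /inH_decomp -> /inH_decomp ->.
set u := f@_0; set v := g@_0; set x := ofW f; set y := ofW g.
suff -> : bracketW (<< u *g 0 >> + toW x) (<< v *g 0 >> + toW y) =
    toW (gwt (fun r => dotZ u r) y - gwt (fun r => dotZ v r) x + gpb wK x y).
  exact: toW_inH'.
rewrite (bracketWDl _ << u *g 0 >>) (bracketWDr << u *g 0 >>) (bracketWDr (toW x)).
rewrite bracketW_cartan add0r bracketW_degree (bracketWC (toW x)) bracketW_degree.
by rewrite -toW_bracket -(morphDN (@toWD K m)) addrA -!toWD.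
Qed.

Lemma inH_lin a f g : inH f -> inH g -> inH (scaleW a f + g).
Proof.
move=> fH gH r r0; have [c Ef] := fH r r0; have [d Eg] := gH r r0.
by exists (a * c + d); rewrite mcoeffD scaleWE Ef Eg scalerA scalerDl.
Qed.

Lemma inH'_lin a f g : inH' f -> inH' g -> inH' (scaleW a f + g).
Proof.
move=> [f0 fH] [g0 gH]; split; last exact: inH_lin.
by rewrite mcoeffD scaleWE f0 g0 scaler0 addr0.
Qed.

(** Used to see that an automorphism of $\mathcal H_N$ keeps $h_r$ inside
    $[\mathcal H_N,\mathcal H_N]$. *)
Lemma toW_bracket_degree a r : exists u, bracketW << u *g 0 >> (toW << a *g r >>) = toW << a *g r >>.
Proof.
have [->|r0] := eqVneq r 0.
  exists 0; rewrite bracketW_degree; apply/malgP => k; rewrite !toWE gwtE mcoeffU.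
  by rewrite dotZ0l mul0r; case: eqP => [<-|_]; rewrite ?rbarK0 ?scaler0.
have [i ri] := zn_neq0 r0.
(* Scaled so that [dotZ u r = 1]. *)
exists (((r i 0)%:~R)^-1 *: delta_mx i 0); rewrite bracketW_degree gwtU dotZZl.
congr (toW (<< _ *g _ >>)); rewrite /dotZ (bigD1 i) //= big1 => [|j /negPf nj].
  by rewrite !mxE !eqxx mul1r addr0 mulVf ?mul1r // intr_eq0_pchar0.
by rewrite mxE nj mul0r.
Qed.

Lemma centralizer_H' f : inH f -> (forall x, bracketW f (toW x) = 0) -> f = 0.
Proof.
move=> fH cent; have Ef := inH_decomp fH; set u := f@_0 in Ef; set x := ofW f in Ef.
(* Coefficient of $[f,h_s]$ in degree [t]: taking [t = s] isolates the Cartan part [u], and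
   [t = r + s] with [r] nonzero isolates [x@_r]. *)
have coef s t : t != 0 -> dotZ u s *+ (s == t) + wK (t - s) s * x@_(t - s) = 0.
  move=> t0; have := cent << s >>.
  rewrite Ef (bracketWDl _ << u *g 0 >>) bracketW_degree -toW_bracket -toWD.
  move=> /(congr1 (mcoeff t)) /eqP; rewrite toWE mcoeff0 scaler_eq0 rbarK_eq0 // (negPf t0) orbF.
  by rewrite mcoeffD gwtU mcoeffU gpb_coefr !mulr1 => /eqP.
have u0 : u = 0.
  apply/matrixP => i j; rewrite ord1 [RHS]mxE.
  have e0 : zdelta i != 0 :> ZN.
    by apply/eqP => /(congr1 (fun v : ZN => v i 0)) /eqP; rewrite !mxE !eqxx.
  have := coef (zdelta i) _ e0; rewrite eqxx subrr wK0l mul0r addr0 mulr1n.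
  rewrite /dotZ (bigD1 i) //= big1 => [|k /negPf nk]; last by rewrite [zdelta i k 0]mxE nk mulr0.
  by rewrite [zdelta i i 0]mxE !eqxx mulr1 addr0.
have x0 r : x@_r = 0.
  have [->|r0] := eqVneq r 0; first exact: ofW0.
  have [i] := omega_nondeg r0; set s := zdelta i; rewrite -(wK_eq0 charK) => rs.
  have rs0 : r + s != 0.
    by apply: contraNneq rs => e; rewrite -[s](addKr r) e addr0 wKNr wKxx oppr0.
  have := coef s _ rs0; rewrite addrK -[X in X == _]add0r (inj_eq (addIr s)) eq_sym (negPf r0).
  by rewrite mulr0n add0r => /eqP; rewrite mulf_eq0 (negPf rs) => /eqP.
apply/malgP => k; rewrite Ef mcoeffD u0 monalgU0 !mcoeff0 toWE x0.
by rewrite scale0r addr0.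
Qed.

Lemma Phi_invertible Q l : inGSp Q -> inTorus l ->
  exists Q' l', [/\ inGSp Q', inTorus l',
    cancel (@Phi K m Q l) (Phi Q' l') & cancel (@Phi K m Q' l') (Phi Q l)].
Proof.
move=> QG lT; have QG' := inGSpV QG; have [Qu _] := QG; have [Qu' _] := QG'.
pose li : KN := \col_i (l i 0)^-1.
have liT : inTorus li by move=> i; rewrite mxE invr_neq0.
have [_ [tactM [tact1 tactA]]] := @tact_gsp_action K m.
(* The inverse of [(Q, l)] in the semidirect product. *)
exists (invmx Q), (tact (invmx Q) li); split=> //; first exact: tact_torus.
  move=> f; rewrite Phi_comp // mulVmx // -tactM //.
  rewrite (_ : tact _ _ = const_mx 1) ?Phi1 //.
  apply/matrixP => i j; rewrite !mxE /tchar big1 // => k _.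
  by rewrite !mxE mulVf // exp1rz.
move=> f; rewrite Phi_comp //; last exact: tact_torus.
rewrite -tactA // mulmxV // tact1 //.
rewrite (_ : tmul _ _ = const_mx 1) ?Phi1 //.
by apply/matrixP => i j; rewrite !mxE mulfV.
Qed.

(** The degree of the image of $h_r$ determines [Q r]; its coefficient then determines the character
    [l] at [Q r]. Testing on the image of [toW] lets this serve both algebras. *)
Lemma Phi_inj Q l Q' l' : inGSp Q -> inTorus l -> inGSp Q' -> inTorus l' ->
  (forall x, Phi Q l (toW x) = Phi Q' l' (toW x)) -> Q = Q' /\ l = l'.
Proof.
move=> QG lT QG' lT' E; have [k [kk Ek Qu]] := inGSp_conformal QG.
have nz r : r != 0 -> dualmx K Q *m rbarK K r != 0.
  move=> r0; rewrite (dualmx_rbar _ _ Qu kk Ek) scaler_eq0 negb_or rbarK_eq0 //.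
  rewrite intr_eq0_pchar0 //; apply/andP; split.
    by apply: contra_eq_neq kk => ->; rewrite mul0r eq_sym oner_neq0.
  by apply: contraNneq r0 => /(congr1 (mulmx (invmx Q))); rewrite mulKmx // mulmx0 => ->.
have Er r : r != 0 -> tchar l (Q *m r) *: (dualmx K Q *m rbarK K r) =
    tchar l' (Q' *m r) *: (dualmx K Q' *m rbarK K r) /\ Q *m r = Q' *m r.
  move=> r0; have := E << r >>; rewrite (toWU 1 r) scale1r !PhiU => /malgU_inj; apply.
  by rewrite scaler_eq0 negb_or tchar_neq0 // nz.
have QQ : Q = Q'.
  apply: mulmx_ext_cV => r; have [->|/Er[]//] := eqVneq r 0; by rewrite !mulmx0.
split=> //; subst Q'; apply/matrixP => i j; rewrite ord1 -!tchar_delta.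
set s := zdelta i; pose r := invmx Q *m s.
have rE : Q *m r = s by rewrite mulKVmx.
have r0 : r != 0.
  apply/eqP => r0; move: rE; rewrite r0 mulmx0 => /(congr1 (fun v : ZN => v i 0)) /eqP.
  by rewrite !mxE !eqxx.
have [+ _] := Er r r0; rewrite rE => /eqP; rewrite -subr_eq0 -scalerBl scaler_eq0.
by rewrite (negPf (nz r r0)) orbF subr_eq0 => /eqP.
Qed.

End HamiltonianAlgebra.

(** * Rigidity of automorphisms and the two group isomorphisms *)

Section LieAutomorphisms.
Variables (K : fieldType) (m : nat).
Hypothesis charK : [pchar K] =i pred0.
Hypothesis m0 : (0 < m)%N.
Local Notation N := (m + m)%N.
Local Notation ZN := (ZN m).
Local Notation J := (Jmx m).
Local Notation KN := (KN K m).
Local Notation W := (W K m).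
Local Notation L := {malg K[ZN]}.
Local Notation wK := (@wK K m).
Implicit Types (r s : ZN) (Q : 'M[int]_N) (l u v : KN) (f g : W) (x y : L).

Lemma sval_inj (T : Type) (P : T -> Prop) (x y : {t | P t}) : sval x = sval y -> x = y.
Proof. by apply: eq_sig_hprop => t p q; apply: Classical_Prop.proof_irrelevance. Qed.

Lemma sub_exists (T : Type) (P : T -> Prop) t : P t -> exists x : {t | P t}, sval x = t.
Proof. by move=> Pt; exists (exist _ t Pt). Qed.

Section Subalgebra.
(** [P] stands for [inH] or [inH'], so that one argument covers both algebras. *)
Variable P : W -> Prop.
Hypothesis P_lin : forall a f g, P f -> P g -> P (scaleW a f + g).
Hypothesis P_bracket : forall f g, P f -> P g -> P (bracketW f g).
Hypothesis P_H' : forall f, inH' f -> P f.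
Local Notation sP := {f : W | P f}.

Lemma isLieAut_inverse (phi psi : sP -> sP) :
  isLieAut phi -> cancel phi psi -> cancel psi phi -> isLieAut psi.
Proof.
move=> [_ [phiL phiB]] phiK psiK; split; first by exists phi.
split=> [a x y z E|x y z E].
  (* [isLieAut] speaks only of elements of the subtype; closure of [P] supplies the one needed. *)
  have [z' Ez] := sub_exists (P_lin a (svalP (psi x)) (svalP (psi y))).
  rewrite -Ez; congr (sval _); apply: (can_inj phiK); rewrite psiK; apply: sval_inj.
  by rewrite (phiL a (psi x) (psi y) z' Ez) !psiK.
have [z' Ez] := sub_exists (P_bracket (svalP (psi x)) (svalP (psi y))).
rewrite -Ez; congr (sval _); apply: (can_inj phiK); rewrite psiK; apply: sval_inj.
by rewrite (phiB (psi x) (psi y) z' Ez) !psiK.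
Qed.

Definition emb x : sP := exist _ _ (P_H' (toW_inH' x)).

Definition transfer (phi : sP -> sP) x : L := ofW (sval (phi (emb x))).

(** [phi] and [psi] keep the image of [emb] inside $\mathcal H_N'$, where [ofW] loses nothing. *)
Lemma transfer_lie_inverse (phi psi : sP -> sP) :
  isLieAut phi -> (forall x, inH' (sval (phi (emb x)))) ->
  (forall x, inH' (sval (psi (emb x)))) -> cancel psi phi ->
  lie_inverse wK (transfer phi) (transfer psi).
Proof.
move=> [_ [phiL phiB]] phiH psiH psiK.
have tL a x y : transfer phi (a *: x + y) = a *: transfer phi x + transfer phi y.
  rewrite /transfer (phiL a (emb x) (emb y)); first by rewrite ofWD ofWZ.
  by rewrite /= toWD toWZ.
have tD : {morph transfer phi : x y / x + y}.
  by move=> x y; rewrite -{1}[x]scale1r tL scale1r.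
split.
- by split=> // a x; rewrite -[a *: x]addr0 tL (morphD0 tD) addr0.
- move=> x y; rewrite /transfer (phiB (emb x) (emb y)); last exact: toW_bracket.
  rewrite -(ofWK charK (phiH x)) -(ofWK charK (phiH y)) -toW_bracket toWK //.
  by rewrite noconst_id ?gpb_coef0 // !toWK // !noconst_id ?ofW0.
- by move=> x; apply: ofW0.
move=> x; rewrite /transfer -(toWK charK); congr (ofW _).
suff -> : emb (ofW (sval (psi (emb x)))) = psi (emb x) by rewrite psiK.
by apply: sval_inj; rewrite /= ofWK.
Qed.

(** The preservation hypothesis quantifies over all automorphisms because the classification needs
    the inverse of [phi] as well. *)
Lemma isLieAut_on_H' (phi : sP -> sP) : isLieAut phi ->
  (forall phi : sP -> sP, isLieAut phi -> forall x, inH' (sval (phi (emb x)))) ->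
  exists Q l, [/\ inGSp Q, inTorus l &
    forall x, sval (phi (emb x)) = Phi Q l (toW x)].
Proof.
move=> phiA AH'; have [[psi phiK psiK] _] := phiA.
have psiA := isLieAut_inverse phiA phiK psiK.
have [Q [l [k [Qu k1 E lT sE]]]] := lie_inverse_classification charK m0
  (transfer_lie_inverse phiA (AH' _ phiA) (AH' _ psiA) psiK)
  (transfer_lie_inverse psiA (AH' _ psiA) (AH' _ phiA) phiK).
have kk : k * k = 1 by case: k1 => ->.
exists Q, l; split=> //.
  by split=> //; rewrite E; case: k1 => ->; rewrite ?scale1r ?scaleN1r; auto.
have [[sD sZ] _ _ _] :=
  transfer_lie_inverse phiA (AH' _ phiA) (AH' _ psiA) psiK.
move=> x; rewrite -(ofWK charK (AH' _ phiA x)) -/(transfer phi x).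
move: x; apply: malg_additive_ext => [x y|x y|r a].
- by rewrite sD toWD.
- by rewrite toWD PhiD.
rewrite [RHS](Phi_toW _ _ _ Qu kk E) malgUZ sZ.
have [->|r0] := eqVneq r 0.
  (* At [r = 0] both sides vanish, because [toW] kills [<<0>>]. *)
  rewrite mulmx0 [RHS]toWU rbarK0 scaler0 monalgU0 toWZ.
  have -> : toW (transfer phi << 0 >>) = 0.
    have -> : transfer phi << 0 >> = transfer phi 0.
      by congr (ofW (sval (phi _))); apply: sval_inj; rewrite /= toWU rbarK0 scaler0 monalgU0
        (morphD0 (@toWD K m)).
    by rewrite (morphD0 sD) (morphD0 (@toWD K m)).
  by rewrite (morphD0 (@scaleWD K m a)).
by rewrite (sE r r0) scale_malgU mulrC.
Qed.

Hypothesis P_Phi : forall Q l f, inGSp Q -> inTorus l -> P f -> P (Phi Q l f).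
Hypothesis P_rigid : forall phi : sP -> sP, isLieAut phi ->
  exists Q l, [/\ inGSp Q, inTorus l & forall x : sP, sval (phi x) = Phi Q l (sval x)].

(** Membership of the image in [P] is known only for pairs in the semidirect product, whereas this
    map must be defined for every pair; [epsilon] fills the gap. *)
Definition gsp_aut (p : 'M[int]_N * KN) (x : sP) : sP :=
  ClassicalEpsilon.epsilon (inhabits x) (fun y : sP => sval y = Phi p.1 p.2 (sval x)).

Lemma gsp_autE p (x : sP) : inSD p -> sval (gsp_aut p x) = Phi p.1 p.2 (sval x).
Proof.
move=> [QG lT]; apply: (ClassicalEpsilon.epsilon_spec (inhabits x)
  (fun y : sP => sval y = Phi p.1 p.2 (sval x))).
by exists (exist _ _ (P_Phi QG lT (svalP x))).
Qed.

(** Injectivity is tested on $\mathcal H_N'$ by [Phi_inj], surjectivity is [P_rigid], and [Phi_comp]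
    gives the product. *)
Lemma gsp_group_iso : group_iso (@inSD K m) (sdmul (@tact K m))
  (@isLieAut K m P) (fun phi psi => phi \o psi).
Proof.
exists gsp_aut; split=> [p pS|].
  have [QG lT] := pS; have [Q' [l' [QG' lT' K1 K2]]] := Phi_invertible QG lT.
  have pS' : inSD (Q', l') by [].
  split; first by exists (gsp_aut (Q', l')) => x; apply: sval_inj; rewrite !gsp_autE //= ?K1 ?K2.
  split=> [a x y z E|x y z E]; rewrite !(gsp_autE _ pS) E.
    by rewrite PhiD Phi_scale.
  exact: (Phi_bracket _ _ (proj1 QG) lT).
split=> [[Q l] [Q' l'] pS pS' E|].
  have [|-> -> //] := @Phi_inj K m charK Q l Q' l' (proj1 pS) (proj2 pS) (proj1 pS') (proj2 pS') => x.
  by have := congr1 (fun F => sval (F (emb x))) E; rewrite !gsp_autE.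
split=> [phi /P_rigid[Q [l [QG lT E]]]|p p' pS pS'].
  have pS : inSD (Q, l) by [].
  exists (Q, l) => //; apply: FunctionalExtensionality.functional_extensionality => x.
  by apply: sval_inj; rewrite gsp_autE // E.
have [QG lT] := pS; have [QG' lT'] := pS'.
have pS2 : inSD (sdmul (@tact K m) p p').
  by split; [exact: inGSpM | apply: tmul_torus => //; apply: tact_torus].
apply: FunctionalExtensionality.functional_extensionality => x.
apply: sval_inj; rewrite gsp_autE //= !gsp_autE // Phi_comp //; first by case: QG.
by case: QG'.
Qed.

End Subalgebra.

Lemma bracketW_inH' f g : inH' f -> inH' g -> inH' (bracketW f g).
Proof. by move=> [_ fH] [_ gH]; apply: inH_bracket. Qed.

Lemma inH'_group_iso : group_iso (@inSD K m) (sdmul (@tact K m))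
  (@isLieAut K m (@inH' K m)) (fun phi psi => phi \o psi).
Proof.
have P_H' f : inH' f -> inH' f by [].
apply: (gsp_group_iso P_H') => [Q l f QG _|phi phiA]; first exact: Phi_inH'.
have [|Q [l [QG lT E]]] := isLieAut_on_H' (@inH'_lin K m) bracketW_inH' (P_H' := P_H') phiA.
  by move=> phi' _ x; apply: svalP.
exists Q, l; split=> // x; rewrite -[in RHS](ofWK charK (svalP x)) -E.
by congr (sval (phi _)); apply: sval_inj; rewrite /= (ofWK charK (svalP x)).
Qed.

Lemma inH'_inH f : inH' f -> inH f. Proof. by case. Qed.

Lemma bracketW_inH f g : inH f -> inH g -> inH (bracketW f g).
Proof. by move=> fH gH; have [_] := inH_bracket charK fH gH. Qed.

(** Each $h_r$ is a bracket in $\mathcal H_N$, hence so is its image; linearity does the rest. *)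
Lemma isLieAut_inH_preserves_H' (phi : {f : W | inH f} -> {f : W | inH f}) :
  isLieAut phi -> forall x, inH' (sval (phi (emb inH'_inH x))).
Proof.
move=> [_ [phiL phiB]].
have AU r a : inH' (sval (phi (emb inH'_inH << a *g r >>))).
  have [u E] := toW_bracket_degree charK a r.
  have uH : inH (<< u *g 0 >> : W).
    by move=> s s0; exists 0; rewrite scale0r mcoeffU eq_sym (negPf s0).
  rewrite (phiB (exist _ _ uH) (emb inH'_inH << a *g r >>)) //.
  by apply: inH_bracket => //; apply: svalP.
apply: malg_ind => // [|x y xH yH]; first by rewrite -(monalgU0 0); apply: AU.
rewrite (phiL 1 (emb inH'_inH x) (emb inH'_inH y)); first exact: inH'_lin.
by rewrite /= scaleW1 toWD.
Qed.

Lemma inH_group_iso : group_iso (@inSD K m) (sdmul (@tact K m))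
  (@isLieAut K m (@inH K m)) (fun phi psi => phi \o psi).
Proof.
apply: (gsp_group_iso inH'_inH) => //.
  by move=> Q l f QG _; apply: Phi_inH.
move=> phi phiA.
have [Q [l [QG lT E]]] := isLieAut_on_H' (@inH_lin K m) bracketW_inH phiA
  isLieAut_inH_preserves_H'.
exists Q, l; split=> // x; have [_ [_ phiB]] := phiA.
have [Q' [l' [QG' _ _ PhiK]]] := Phi_invertible QG lT.
(* It is enough that the difference of [phi x] and [Phi Q l x] centralizes $\mathcal H_N'$. *)
apply/eqP; rewrite -subr_eq0; apply/eqP; apply: (centralizer_H' charK).
  have := inH_lin (-1) (Phi_inH l QG (svalP x)) (svalP (phi x)).
  suff -> : scaleW (-1) (Phi Q l (sval x)) = - Phi Q l (sval x) by rewrite addrC.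
  by apply/malgP => k; rewrite scaleWE mcoeffN scaleN1r.
(* Any element of $\mathcal H_N'$ is [Phi Q l] of some [toW y']; as $[x,y']$ is in $\mathcal H_N'$,
   [phi] and [Phi Q l] agree on it as well as on [y']. *)
move=> y; have yH := Phi_inH' l' QG' (toW_inH' y).
rewrite -[toW y]PhiK -(ofWK charK yH); set y' := ofW _.
rewrite bracketWDl (morphDN (@bracketWDl K m _)) -Phi_bracket //; last by case: QG.
apply/eqP; rewrite subr_eq0 -E; apply/eqP.
have zH := inH_bracket charK (svalP x) (inH'_inH (toW_inH' y')).
rewrite -(phiB x (emb inH'_inH y') (emb inH'_inH (ofW (bracketW (sval x) (toW y'))))).
  by rewrite E /= (ofWK charK zH).
by rewrite /= (ofWK charK zH).
Qed.

End LieAutomorphisms.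

Theorem theorem3p6 (K : closedFieldType) (hK : [pchar K] =i pred0)
  (m : nat) (hm : (0 < m)%N) :
  exists act : 'M[int]_(m + m) -> 'cV[K]_(m + m) -> 'cV[K]_(m + m),
    gsp_action act /\
    group_iso (@inSD K m) (sdmul act)
      (@isLieAut K m (@inH K m)) (fun phi psi => phi \o psi) /\
    group_iso (@inSD K m) (sdmul act)
      (@isLieAut K m (@inH' K m)) (fun phi psi => phi \o psi).
Proof.
exists (@tact K m); split; first exact: tact_gsp_action.
by split; [exact: inH_group_iso | exact: inH'_group_iso].
Qed.
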